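(* The Furstenberg set $S=\{2^j3^k: j,k\ge0\}$ is $3/2$-Rider. More generally, let $s\ge2$ and let $q_1,\ldots,q_s\ge2$ be pairwise coprime integers. Then: (1) the set $S(q_1,\ldots,q_s)$ is $\frac{2s-1}{s}$-Rider; (2) the set $S(q_1,\ldots,q_s)$ is not $p$-Rider for any $1\le p<\frac{2s}{s+1}$.
   Context: $S(q_1,\ldots,q_s)=\{q_1^{a_1}\cdots q_s^{a_s}: a_1,\ldots,a_s\in\{0,1,2,\ldots\}\}$ is the multiplicative semigroup generated by $q_1,\ldots,q_s$. $\mathbb N=\{1,2,\ldots\}$, $\mathbb T=\mathbb R/\mathbb Z$, $e_k(x)=e^{2i\pi kx}$. For $\Lambda\subset\mathbb N$, $\mathcal P_\Lambda$ is the set of trigonometric polynomials $f=\sum_{k\in\Lambda}a_ke_k$ (finite sums, complex coefficients) with spectrum in $\Lambda$; $\widehat f(k)=a_k$. If $(\varepsilon_k)$ is a Rademacher sequence (i.i.d., values $\pm1$ with probability $1/2$), put $f_\omega=\sum_k\varepsilon_k(\omega)a_ke_k$ and $[f]=\mathbb E(\|f_\omega\|_\infty)$, where $\|\cdot\|_\infty$ is the sup norm on $\mathbb T$. For $1\le p<2$, a set $\Lambda\subset\mathbb N$ is called $p$-Rider if there is a constant $C$ such that $\big(\sum_k|\widehat f(k)|^p\big)^{1/p}\le C[f]$ for every $f\in\mathcal P_\Lambda$. *)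

(* Defs.v *)
From HB Require Import structures.
From mathcomp Require Import all_boot all_order all_algebra finmap.
From mathcomp Require Import complex.
From mathcomp Require Import all_classical all_reals all_analysis.

Set Implicit Arguments.
Unset Strict Implicit.
Unset Printing Implicit Defensive.

Import Order.TTheory GRing.Theory Num.Theory.
Import numFieldNormedType.Exports.

Local Open Scope classical_set_scope.
Local Open Scope ring_scope.

Definition semigroup_gen (s : nat) (q : 'I_s -> nat) : set nat :=
  [set n | exists a : 'I_s -> nat, n = (\prod_(i < s) q i ^ a i)%N].

Definition furstenberg_set : set nat :=
  [set n | exists j k : nat, n = (2 ^ j * 3 ^ k)%N].

Section TrigonometricPolynomials.
Variable R : realType.

(* A function on the circle R/Z is represented by its 1-periodic lift to R. *)
Definition e_ (k : nat) (x : R) : R[i] :=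
  Complex (cos (2 * pi * k%:R * x)) (sin (2 * pi * k%:R * x)).

(* A trigonometric polynomial with nonnegative spectrum is given by its
   finitely supported family of coefficients, so [f k] is the k-th Fourier
   coefficient of f. *)
Definition trigpoly := {fsfun nat -> R[i] with 0}.

Definition trig_eval (f : trigpoly) (x : R) : R[i] :=
  \sum_(k <- finsupp f) f k * e_ k x.

Definition spectrum_in (Lambda : set nat) (f : trigpoly) : Prop :=
  forall k, f k != 0 -> Lambda k.

(* The norm of R[i] is R[i]-valued; its real part is the modulus in R. *)
Definition cmod (z : R[i]) : R := complex.Re `|z|.

Definition sup_norm (f : trigpoly) : R :=
  sup (range (fun x : R => cmod (trig_eval f x))).

Definition lp_coef (p : R) (f : trigpoly) : R :=
  (\sum_(k <- finsupp f) cmod (f k) `^ p) `^ p^-1.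

Definition scale_coef (t : nat -> R) (f : trigpoly) : trigpoly :=
  [fsfun k in finsupp f => (t k)%:C%C * f k | 0].

End TrigonometricPolynomials.

Section Rider.
Context (R : realType) (d : measure_display) (Omega : measurableType d).
Variable P : probability Omega R.

Definition mutually_independent (X : nat -> {RV P >-> R}) : Prop :=
  forall (I : {fset nat}) (B : nat -> set R),
    (forall i, measurable (B i)) ->
    P (\bigcap_(i in [set` I]) (X i @^-1` B i)) =
    (\prod_(i <- I) P (X i @^-1` B i))%E.

Definition rademacher (eps : nat -> {RV P >-> R}) : Prop :=
  mutually_independent eps /\
  forall k, P (eps k @^-1` [set 1]) = (2^-1)%:E /\
            P (eps k @^-1` [set -1]) = (2^-1)%:E.

Definition rider_norm (eps : nat -> {RV P >-> R}) (f : trigpoly R) : \bar R :=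
  ('E_P[fun w => sup_norm (scale_coef (fun k => eps k w) f)])%E.

Definition is_Rider (eps : nat -> {RV P >-> R}) (p : R) (Lambda : set nat)
    : Prop :=
  exists C : R, forall f : trigpoly R, spectrum_in Lambda f ->
    ((lp_coef p f)%:E <= C%:E * rider_norm eps f)%E.

End Rider.

(* Main.v *)
Require Import Defs.
From HB Require Import structures.
From mathcomp Require Import all_boot all_order all_algebra finmap.
From mathcomp Require Import complex.
From mathcomp Require Import all_classical all_reals all_analysis.
From mathcomp Require Import measurable_realfun.
From mathcomp Require Import zify ring lra.

Set Implicit Arguments.
Unset Strict Implicit.
Unset Printing Implicit Defensive.

Import Order.TTheory GRing.Theory Num.Theory.
Import numFieldNormedType.Exports.

Local Open Scope classical_set_scope.
Local Open Scope ring_scope.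

(* Let [f] = E ||f_w||_oo and suppose that q^{v(k)} exactly divides each k in a
   finite set A. Testing the sup norm of f_w against the Riesz products
   prod_k (1 + t e_k Re(a_k e_k(x))), averaged over q-adic rational points x,
   tilts the signs so that f_w becomes large. The cost of the tilting is its
   entropy, which is small because the partial sums over the levels v(k) = j
   form a q-adic martingale in x; bounded differences and the Gibbs variational
   principle then give
     [f] >= c (sum_{k in A} |a_k|^2) / sqrt (max_j sum_{v(k) = j} |a_k|^2).
   If n coefficients of f on S(q_1, ..., q_s) have size about b, most of them
   lie, in some direction i, on fibers of the q_i-valuation with O(n^{1 - 1/s})
   points, whence b n^{(s+1)/(2s)} <= C [f]. This is a weak-type bound with
   exponent 2s/(s+1), and summing over dyadic levels gives the l^p bound for
   every p > 2s/(s+1), in particular for p = (2s-1)/s.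

   Conversely, the sum of e_k over the N^s numbers k = prod_i q_i^{a_i} with
   a_i < N has degree exp(O(N)), so a union bound over exp(O(N)) points gives
   [f] = O(sqrt (N^s * N)), while its l^p norm of coefficients is N^{s/p}. *)

(** * Means over lists and over sign vectors *)

Section Mean.
Variable R : realType.

Definition mean (T : Type) (s : seq T) (G : T -> R) : R :=
  (\sum_(x <- s) G x) / (size s)%:R.

Lemma eq_mean (T : Type) (s : seq T) (G H : T -> R) :
  G =1 H -> mean s G = mean s H.
Proof. by move=> GH; rewrite /mean; congr (_ / _); apply: eq_bigr => x _. Qed.

Lemma ler_mean (T : Type) (s : seq T) (G H : T -> R) :
  (forall x, G x <= H x) -> mean s G <= mean s H.
Proof.
by move=> GH; rewrite /mean ler_wpM2r ?invr_ge0 ?ler0n//; apply: ler_sum.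
Qed.

Lemma meanD (T : Type) (s : seq T) (G H : T -> R) :
  mean s (fun x => G x + H x) = mean s G + mean s H.
Proof. by rewrite /mean big_split mulrDl. Qed.

Lemma meanZ (T : Type) (s : seq T) (c : R) (G : T -> R) :
  mean s (fun x => c * G x) = c * mean s G.
Proof. by rewrite /mean -mulr_sumr mulrA. Qed.

Lemma mean_sum (T I : Type) (s : seq T) (r : seq I) (G : I -> T -> R) :
  mean s (fun x => \sum_(i <- r) G i x) = \sum_(i <- r) mean s (G i).
Proof. by rewrite /mean exchange_big mulr_suml. Qed.

Lemma mean_cst (T : Type) (s : seq T) (c : R) :
  (0 < size s)%N -> mean s (fun=> c) = c.
Proof.
move=> s0; rewrite /mean big_const_seq count_predT iter_addr_0.
by rewrite -[c *+ _]mulr_natr mulfK// pnatr_eq0 -lt0n.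
Qed.

Lemma mean_exchange (T U : Type) (s : seq T) (r : seq U) (G : T -> U -> R) :
  mean s (fun x => mean r (G x)) = mean r (fun y => mean s (G ^~ y)).
Proof. by rewrite /mean -!mulr_suml exchange_big mulrAC. Qed.

Lemma mean_cat (T : Type) (s r : seq T) (G : T -> R) :
  size s = size r -> mean (s ++ r) G = (mean s G + mean r G) / 2.
Proof.
move=> sr; rewrite /mean big_cat size_cat sr natrD -mulrDl -mulrA -invfM.
by congr (_ / _); rewrite mulr_natr mulr2n.
Qed.

Lemma mean_map (T U : Type) (h : T -> U) (s : seq T) (G : U -> R) :
  mean (map h s) G = mean s (G \o h).
Proof. by rewrite /mean big_map size_map. Qed.

Lemma mean_allpairs (T U V : Type) (h : T -> U -> V) s r (G : V -> R) :
  mean [seq h x y | x <- s, y <- r] G =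
  mean s (fun x => mean r (fun y => G (h x y))).
Proof.
rewrite /mean size_allpairs big_allpairs_dep -mulr_suml natrM invfM.
by rewrite [(size s)%:R^-1 * _]mulrC mulrA.
Qed.

Definition upd (e : nat -> R) (k : nat) (v : R) : nat -> R :=
  fun i => if i == k then v else e i.

(** The value 0 off [l] matters: used as multipliers in [scale_coef], these vectors delete the
    frequencies outside [l], so restricting to part of a spectrum only shortens the list. *)
Fixpoint signs (l : seq nat) : seq (nat -> R) :=
  if l is k :: l' then
    [seq upd e k 1 | e <- signs l'] ++ [seq upd e k (-1) | e <- signs l']
  else [:: fun=> 0].

Definition sign_vector (l : seq nat) (e : nat -> R) : Prop :=
  forall k, if k \in l then e k = 1 \/ e k = -1 else e k = 0.

Lemma sign_vector_cons k l e v : sign_vector l e -> v = 1 \/ v = -1 ->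
  sign_vector (k :: l) (upd e k v).
Proof.
move=> le v1 i; rewrite inE /upd; case: eqVneq => //= _; exact: (le i).
Qed.

Lemma size_signs l : size (signs l) = (2 ^ size l)%N.
Proof.
by elim: l => // k l IH; rewrite /= size_cat !size_map IH addnn expnS mul2n.
Qed.

Lemma mean_signs_cons k l F :
  mean (signs (k :: l)) F =
  (mean (signs l) (fun e => F (upd e k 1)) +
   mean (signs l) (fun e => F (upd e k (-1)))) / 2.
Proof. by rewrite /= mean_cat ?size_map// !mean_map. Qed.

Lemma mean_signs_nil F : mean (signs [::]) F = F (fun=> 0).
Proof. by rewrite /mean /= big_seq1 divr1. Qed.

Lemma mean_signs_cst l c : mean (signs l) (fun=> c) = c.
Proof. by rewrite mean_cst// size_signs expn_gt0. Qed.

Lemma ler_mean_signs l F G :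
  (forall e, sign_vector l e -> F e <= G e) ->
  mean (signs l) F <= mean (signs l) G.
Proof.
elim: l F G => [|k l IH] F G FG.
  by rewrite !mean_signs_nil; apply: FG.
rewrite !mean_signs_cons ler_pM2r ?invr_gt0//.
by apply: lerD; apply: IH => e le; apply: FG; apply: sign_vector_cons => //;
  [left|right].
Qed.

Lemma eq_mean_signs l F G :
  (forall e, sign_vector l e -> F e = G e) ->
  mean (signs l) F = mean (signs l) G.
Proof.
by move=> FG; apply/le_anti/andP; split; apply: ler_mean_signs => e /FG ->.
Qed.

Lemma eq_sum_signs l (F G : (nat -> R) -> R) :
  (forall e, sign_vector l e -> F e = G e) ->
  \sum_(e <- signs l) F e = \sum_(e <- signs l) G e.
Proof.
move=> /eq_mean_signs; apply: mulIf.
by rewrite invr_eq0 pnatr_eq0 size_signs -lt0n expn_gt0.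
Qed.

(** Independence of the signs; [uniq l] keeps the update at the head from touching the other
    factors. *)
Lemma mean_signs_prod l (phi : nat -> R -> R) : uniq l ->
  mean (signs l) (fun e => \prod_(k <- l) phi k (e k)) =
  \prod_(k <- l) ((phi k 1 + phi k (-1)) / 2).
Proof.
elim: l => [|k l IH] /=; first by rewrite mean_signs_nil !big_nil.
move=> /andP[kl ul]; rewrite mean_signs_cons big_cons -IH//.
have E v : mean (signs l) (fun e => \prod_(i <- k :: l) phi i (upd e k v i)) =
    phi k v * mean (signs l) (fun e => \prod_(i <- l) phi i (e i)).
  rewrite -meanZ; apply: eq_mean => e; rewrite big_cons {1}/upd eqxx.
  congr (_ * _); apply: eq_big_seq => i il; rewrite /upd ifN//.
  by apply: contraNneq kl => <-.
by rewrite !E; lra.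
Qed.

(* Jensen's inequality: the signs of [l1] are replaced by their mean 0. *)
Lemma mean_signs_catr l1 l2 F : uniq (l1 ++ l2) ->
  (forall e k, k \in l1 -> e k = 0 ->
     F e <= (F (upd e k 1) + F (upd e k (-1))) / 2) ->
  mean (signs l2) F <= mean (signs (l1 ++ l2)) F.
Proof.
elim: l1 => [//|k l1 IH] /= /andP[kl ul] Fc.
apply: (le_trans (IH ul _)).
  by move=> e i il; apply: Fc; rewrite inE il orbT.
rewrite mean_signs_cons -meanD mulrC -meanZ.
apply: ler_mean_signs => e le; rewrite mulrC; apply: Fc; rewrite ?mem_head//.
by have := le k; rewrite (negPf kl).
Qed.

(** * Exponential moments and concentration *)

Lemma expR_le_quadratic (x : R) : x <= 1 -> expR x <= 1 + x + 2 * x ^+ 2.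
Proof.
move=> x1; rewrite -[x in expR x]opprK expRN.
rewrite -[leLHS]mul1r ler_pdivrMr ?expR_gt0//.
have h : (1 - x / 2) ^+ 2 <= expR (- x).
  have -> : - x = (- (x / 2)) + (- (x / 2)) by lra.
  rewrite expRD -expr2 ler_sqr ?nnegrE ?expR_ge0//; last by lra.
  exact: expR_ge1Dx.
have p0 : 0 <= 1 + x + 2 * x ^+ 2 by nra.
apply: le_trans (ler_wpM2l p0 h).
(* [(1 - x / 2) ^+ 2 * (1 + x + 2 * x ^+ 2)] exceeds 1 by exactly half of [x ^+ 2] times this
   product. *)
have y0 : 0 <= (1 - x) * (5 / 2 - x) by apply: mulr_ge0; lra.
have : 0 <= x ^+ 2 * ((1 - x) * (5 / 2 - x)) by rewrite mulr_ge0// sqr_ge0.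
by nra.
Qed.

(** The linear term stands alone so that it vanishes on averaging a centred variable. This yields
    Hoeffding's lemma with the constant 2 in place of 1/2. *)
Lemma expR_le_addr_sqr (x : R) : expR x <= x + expR (2 * x ^+ 2).
Proof.
have [x1|x1] := leP x 1.
  apply: (le_trans (expR_le_quadratic x1)).
  by have := expR_ge1Dx (2 * x ^+ 2); lra.
have : expR x <= expR (2 * x ^+ 2) by rewrite ler_expR; nra.
lra.
Qed.

Lemma mean_expR_centered (T : Type) (s : seq T) (g : T -> R) (c : R) :
  (0 < size s)%N -> \sum_(x <- s) g x = 0 -> (forall x, `|g x| <= c) ->
  mean s (fun x => expR (g x)) <= expR (2 * c ^+ 2).
Proof.
move=> s0 g0 gc.
apply: (@le_trans _ _ (mean s (fun x => g x + expR (2 * c ^+ 2)))).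
  apply: ler_mean => x; apply: (le_trans (expR_le_addr_sqr _)).
  rewrite lerD2l ler_expR ler_pM2l// -[g x ^+ 2]real_normK ?num_real//.
  by rewrite ler_sqr ?nnegrE// (le_trans _ (gc x)).
by rewrite meanD mean_cst// /mean g0 mul0r add0r.
Qed.

Lemma cosh_le_expR_sqr (x : R) :
  (expR x + expR (- x)) / 2 <= expR (2 * x ^+ 2).
Proof.
have h1 := expR_le_addr_sqr x; have := expR_le_addr_sqr (- x).
by rewrite sqrrN; lra.
Qed.

(** McDiarmid's inequality in exponential form. Condition on the sign of the head: the two
    conditional means are [m + d] and [m - d] with [|d| <= c k], and the induction hypothesis
    applies to each conditional function. *)
Lemma mean_signs_expR_bounded_diff l (F : (nat -> R) -> R) (c : nat -> R)
    (lam : R) : uniq l ->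
  (forall e k v w, k \in l -> (v = 1 \/ v = -1) -> (w = 1 \/ w = -1) ->
     F (upd e k v) - F (upd e k w) <= 2 * c k) ->
  mean (signs l) (fun e => expR (lam * (F e - mean (signs l) F))) <=
  expR (2 * lam ^+ 2 * \sum_(k <- l) c k ^+ 2).
Proof.
elim: l F => [|k l IH] F.
  by move=> _ _; rewrite !mean_signs_nil subrr big_nil !mulr0.
rewrite cons_uniq => /andP[kl ul] Fc; set m := mean (signs (k :: l)) F.
rewrite mean_signs_cons; pose Fv v e := F (upd e k v).
pose mv v := mean (signs l) (Fv v).
have mE : m = (mv 1 + mv (-1)) / 2 by rewrite /m mean_signs_cons.
have step v : v = 1 \/ v = -1 ->
    mean (signs l) (fun e => expR (lam * (F (upd e k v) - m))) <=
    expR (lam * (mv v - m)) * expR (2 * lam ^+ 2 * \sum_(i <- l) c i ^+ 2).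
  move=> v1.
  have h : mean (signs l) (fun e => expR (lam * (Fv v e - mv v))) <=
      expR (2 * lam ^+ 2 * \sum_(i <- l) c i ^+ 2).
    apply: IH => //.
    move=> e i a b il a1 b1; rewrite /Fv.
    have ik : i != k by apply: contraNneq kl => <-.
    have C x : upd (upd e i x) k v = upd (upd e k v) i x.
      apply/funext => j; rewrite /upd; case: eqVneq => // ->.
      by rewrite eq_sym (negPf ik).
    by rewrite !C; apply: Fc => //; rewrite inE il orbT.
  apply: le_trans (ler_wpM2l (expR_ge0 (lam * (mv v - m))) h).
  rewrite -meanZ; apply: ler_mean => e; rewrite -expRD -mulrDr.
  suff -> : mv v - m + (Fv v e - mv v) = F (upd e k v) - m by [].
  by rewrite /Fv; ring.
have h1 := step 1 (or_introl erefl); have h2 := step (-1) (or_intror erefl).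
set d := (mv 1 - mv (-1)) / 2.
have d1 : mv 1 - m = d by rewrite mE /d; lra.
have d2 : mv (-1) - m = - d by rewrite mE /d; lra.
have dc : `|d| <= c k.
  have D v w : v = 1 \/ v = -1 -> w = 1 \/ w = -1 -> mv v - mv w <= 2 * c k.
    move=> v1 w1; rewrite -(mean_signs_cst l (2 * c k)) lerBlDr -meanD.
    by apply: ler_mean => e; rewrite -lerBlDr; apply: Fc; rewrite ?mem_head.
  have := D 1 (-1) (or_introl erefl) (or_intror erefl).
  have := D (-1) 1 (or_intror erefl) (or_introl erefl).
  by rewrite ler_norml /d => ? ?; lra.
rewrite d1 in h1; rewrite d2 in h2; rewrite big_cons mulrDr expRD.
set E := expR (2 * lam ^+ 2 * \sum_(i <- l) _) in h1 h2 *.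
apply: (@le_trans _ _ ((expR (lam * d) + expR (lam * - d)) / 2 * E)).
  by rewrite mulrAC ler_pM2r ?invr_gt0// mulrDl lerD.
rewrite ler_pM2r ?expR_gt0// mulrN.
apply: (le_trans (cosh_le_expR_sqr _)).
rewrite ler_expR exprMn -mulrA ler_pM2l// ler_wpM2l ?sqr_ge0//.
rewrite -[d ^+ 2]real_normK ?num_real//.
by rewrite ler_sqr ?nnegrE// (le_trans _ dc).
Qed.

(* The entropy of the density [rho] is at most [kappa], and the Gibbs
   variational principle compares the tilted mean of [F] with its mean; the
   logarithm of [rho] is majorized by its tangent at [expR kappa]. *)
Lemma mean_density_le l (F rho : (nat -> R) -> R) (lam eta kappa : R) :
  0 < lam ->
  (forall e, sign_vector l e -> 0 <= rho e) ->
  mean (signs l) rho = 1 ->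
  mean (signs l) (fun e => rho e ^+ 2) <= expR kappa ->
  mean (signs l) (fun e => expR (lam * (F e - mean (signs l) F))) <= expR eta ->
  mean (signs l) (fun e => F e * rho e) <=
    mean (signs l) F + (eta + kappa) / lam.
Proof.
move=> lam0 rho0 rho1 rho2 Feta; set m := mean _ F in Feta *.
set K := expR kappa in rho2 *; have K0 : 0 < K by exact: expR_gt0.
have young (r a : R) : 0 <= r ->
    r * (1 + (a - (r / K - 1 + kappa))) <= expR a.
  move=> r0; set y := r / K - 1 + kappa.
  have ry : r <= expR y.
    rewrite /y expRD -/K -ler_pdivrMr//.
    by have := expR_ge1Dx (r / K - 1); lra.
  have -> : expR a = expR y * expR (a - y) by rewrite -expRD addrC subrK.
  apply: (@le_trans _ _ (r * expR (a - y))).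
    by rewrite ler_wpM2l// expR_ge1Dx.
  by rewrite ler_wpM2r// expR_ge0.
(* This is [young] at [a = lam * (F e - m) - eta], sorted by powers of [rho e]; the shift by [eta]
   makes the mean of the right-hand side at most 1. *)
have : mean (signs l) (fun e =>
    lam * (F e * rho e) + ((2 - kappa - eta - lam * m) * rho e
      + (- K^-1) * rho e ^+ 2)) <=
  mean (signs l) (fun e => expR (- eta) * expR (lam * (F e - m))).
  apply: ler_mean_signs => e /rho0 r0; rewrite -expRD.
  by apply: le_trans (young _ (- eta + lam * (F e - m)) r0); lra.
rewrite !meanD !meanZ rho1 mulr1 => h.
have h1 : expR (- eta) * mean (signs l) (fun e => expR (lam * (F e - m))) <= 1.
  by rewrite expRN mulrC ler_pdivrMr ?expR_gt0// mul1r.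
have h2 : K^-1 * mean (signs l) (fun e => rho e ^+ 2) <= 1.
  by rewrite mulrC ler_pdivrMr// mul1r.
rewrite -lerBlDl ler_pdivlMr// mulrC mulrBr.
lra.
Qed.

End Mean.
Arguments signs {R} l.

(** * Exponentials on the circle and q-adic grids *)

Section Waves.
Variable R : realType.
Implicit Types (x y : R) (z a : R[i]).

(** The boolean lets the choice of real or imaginary part be averaged over: the two squares add up
    to the squared modulus whatever the phase. *)
Definition part (b : bool) (z : R[i]) : R :=
  if b then complex.Re z else complex.Im z.

Lemma partD b z a : part b (z + a) = part b z + part b a.
Proof. by case: b; case: z => ? ?; case: a. Qed.

Lemma part0 b : part b 0 = 0. Proof. by case: b. Qed.

Lemma part_sum b (I : Type) (s : seq I) (F : I -> R[i]) :
  part b (\sum_(i <- s) F i) = \sum_(i <- s) part b (F i).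
Proof.
by elim: s => [|i s IH]; rewrite ?big_nil ?part0// !big_cons partD IH.
Qed.

Lemma partZ b (t : R) z : part b (t%:C%C * z) = t * part b z.
Proof. by case: b; case: z => u v /=; rewrite mul0r ?subr0 ?addr0. Qed.

Lemma cmodE z : cmod z = Num.sqrt (part true z ^+ 2 + part false z ^+ 2).
Proof. by case: z. Qed.

Lemma cmod_ge0 z : 0 <= cmod z. Proof. by rewrite cmodE sqrtr_ge0. Qed.

Lemma sqr_cmod z : part true z ^+ 2 + part false z ^+ 2 = cmod z ^+ 2.
Proof. by rewrite cmodE sqr_sqrtr// addr_ge0 ?sqr_ge0. Qed.

Lemma normC_cmod z : `|z| = (cmod z)%:C%C.
Proof. by case: z => u v; rewrite /cmod normc_def. Qed.

Lemma cmodM z a : cmod (z * a) = cmod z * cmod a.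
Proof. by rewrite {1}/cmod normrM !normC_cmod /= mulr0 subr0. Qed.

Lemma cmodD z a : cmod (z + a) <= cmod z + cmod a.
Proof. by have := ler_normD z a; rewrite !normC_cmod -rmorphD/= lecR. Qed.

Lemma cmod0 : cmod (0 : R[i]) = 0.
Proof. by rewrite /cmod normr0. Qed.

Lemma cmod_real (t : R) : cmod (t%:C%C : R[i]) = `|t|.
Proof. by rewrite cmodE /= expr0n addr0 sqrtr_sqr. Qed.

Lemma cmod_sum (I : Type) (s : seq I) (F : I -> R[i]) :
  cmod (\sum_(i <- s) F i) <= \sum_(i <- s) cmod (F i).
Proof.
elim: s => [|i s IH]; first by rewrite !big_nil cmod0.
by rewrite !big_cons (le_trans (cmodD _ _))// lerD2l.
Qed.

Lemma norm_part_le b z : `|part b z| <= cmod z.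
Proof.
rewrite cmodE -sqrtr_sqr ler_wsqrtr//.
by case: b; rewrite ?lerDl ?lerDr sqr_ge0.
Qed.

Lemma cmod_le_parts z : cmod z <= `|part true z| + `|part false z|.
Proof.
rewrite -[leRHS]ger0_norm ?addr_ge0// -sqrtr_sqr cmodE ler_wsqrtr//.
rewrite sqrrD !real_normK ?num_real//.
by rewrite addrAC lerDl mulrn_wge0// mulr_ge0.
Qed.

Lemma cmod_e k x : cmod (e_ k x) = 1.
Proof. by rewrite cmodE /= cos2Dsin2 sqrtr1. Qed.

Lemma e_D k x y : e_ k (x + y) = e_ k x * e_ k y.
Proof.
rewrite /e_ mulrDr cosD sinD; apply/eqP; rewrite eq_complex/=.
by rewrite eqxx/= addrC.
Qed.

Lemma e_1 k : e_ k (1 : R) = 1.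
Proof.
rewrite /e_ mulr1 -[2 * pi * _](add0r) -mulrA [pi * _]mulrC mulrCA mulr_natl.
have -> : 2 * pi = pi *+ 2 :> R by rewrite mulr_natl.
by rewrite (periodicn (@cosD2pi R)) (periodicn (@sinD2pi R)) cos0 sin0.
Qed.

Lemma e_periodic k x : e_ k (x + 1) = e_ k x.
Proof. by rewrite e_D e_1 mulr1. Qed.

Lemma e_0 k : e_ k (0 : R) = 1.
Proof. by rewrite /e_ mulr0 cos0 sin0. Qed.

Lemma e_periodicn k (n : nat) x : e_ k (x + n%:R) = e_ k x.
Proof.
by elim: n => [|n IH]; rewrite ?addr0// mulrSr addrA e_periodic IH.
Qed.

Lemma e_dilate (m k : nat) x : e_ (m * k)%N x = e_ k (m%:R * x).
Proof.
rewrite /e_ natrM; suff -> : 2 * pi * (m%:R * k%:R) * x =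
  2 * pi * k%:R * (m%:R * x) by [].
by ring.
Qed.

(** Reducing [k] modulo [q] puts the half angle strictly between 0 and [pi], where the sine is
    positive. *)
Lemma e_neq1 (q k : nat) : (0 < q)%N -> ~~ (q %| k)%N ->
  e_ k (q%:R^-1 : R) != 1.
Proof.
move=> q0 qk; have qn0 : q%:R != 0 :> R by rewrite pnatr_eq0 -lt0n.
have -> : e_ k (q%:R^-1 : R) = e_ 1 ((k %% q)%:R / q%:R).
  rewrite -[k]muln1 e_dilate {1}(divn_eq k q) natrD natrM mulrDl mulfK//.
  by rewrite addrC e_periodicn muln1.
have r0 : 0 < (k %% q)%:R :> R by rewrite ltr0n lt0n.
have rq : (k %% q)%:R < q%:R :> R by rewrite ltr_nat ltn_mod.
have q0' : 0 < q%:R :> R by rewrite ltr0n.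
set t := _ / _; have t0 : 0 < t by rewrite divr_gt0.
have t1 : t < 1 by rewrite ltr_pdivrMr// mul1r.
have s0 : 0 < sin (pi * t).
  by apply: sin_gt0_pi; rewrite mulr_gt0 ?pi_gt0//= gtr_pMr ?pi_gt0.
apply/negP => /eqP[]; rewrite mulr1.
have -> : 2 * pi * t = (pi * t) *+ 2 by rewrite mulr2n; ring.
by rewrite cos_mulr2n cos2sin2 => c1 _; have := exprn_gt0 2 s0; lra.
Qed.

(** A geometric sum over a nontrivial q-th root of unity. The points summed over are the [q]
    preimages of [y] under multiplication by [q] on the circle, so this is the martingale difference
    property. *)
Lemma sum_e_eq0 (q k : nat) y : (0 < q)%N -> ~~ (q %| k)%N ->
  \sum_(d <- iota 0 q) e_ k ((d%:R + y) / q%:R) = 0.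
Proof.
move=> q0 qk; set w := e_ k (q%:R^-1 : R).
have qn0 : q%:R != 0 :> R by rewrite pnatr_eq0 -lt0n.
have wX d : e_ k (d%:R / q%:R : R) = w ^+ d.
  elim: d => [|d IH]; first by rewrite mul0r e_0 expr0.
  by rewrite mulrSr mulrDl e_D IH mul1r exprSr.
have -> : \sum_(d <- iota 0 q) e_ k ((d%:R + y) / q%:R) =
    (\sum_(d < q) w ^+ d) * e_ k (y / q%:R).
  rewrite mulr_suml -(big_mkord xpredT (fun d => w ^+ d * e_ k (y / q%:R))).
  by rewrite /index_iota subn0; apply: eq_bigr => d _; rewrite mulrDl e_D wX.
suff -> : \sum_(d < q) w ^+ d = 0 by rewrite mul0r.
have : (w - 1) * \sum_(d < q) w ^+ d = 0.
  by rewrite -subrX1 -wX divff// e_1 subrr.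
by move/eqP; rewrite mulf_eq0 subr_eq0 (negPf (e_neq1 q0 qk)) => /eqP.
Qed.

(** The points [i / q ^ L] of the unit interval, built by prefixing the leading q-adic digit; modulo
    1, multiplication by [q] deletes that digit. *)
Fixpoint grid (q L : nat) : seq R :=
  if L is L'.+1 then
    [seq (d%:R + y) / q%:R | d <- iota 0 q, y <- grid q L']
  else [:: 0].

Lemma size_grid q L : size (grid q L) = (q ^ L)%N.
Proof. by elim: L => //= L IH; rewrite size_allpairs size_iota IH expnS. Qed.

(* Read from the last digit to the first, the terms [h j (q ^ j * x)] are
   martingale differences. *)
Lemma mean_grid_expR (q L : nat) (h : nat -> R -> R) (c : nat -> R) :
  (0 < q)%N ->
  (forall j x, h j (x + 1) = h j x) ->
  (forall j y, \sum_(d <- iota 0 q) h j ((d%:R + y) / q%:R) = 0) ->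
  (forall j x, `|h j x| <= c j) ->
  mean (grid q L) (fun x => expR (\sum_(j < L) h j ((q ^ j)%:R * x))) <=
  expR (2 * \sum_(j < L) c j ^+ 2).
Proof.
move=> q0; elim: L h c => [|L IH] h c hp h0 hc.
  by rewrite /mean /= big_seq1 !big_ord0 mulr0 divr1.
have qn0 : q%:R != 0 :> R by rewrite pnatr_eq0 -lt0n.
have hn j x (n : nat) : h j (x + n%:R) = h j x.
  by elim: n => [|n IHn]; rewrite ?addr0// mulrSr addrA hp IHn.
rewrite [grid _ _]/= mean_allpairs mean_exchange.
pose G y := \sum_(j < L) h j.+1 ((q ^ j)%:R * y).
(* By periodicity the terms with [j >= 1] see only the tail [y], so the leading digit [d] is
   averaged in the term [j = 0] alone. *)
have E y : mean (iota 0 q) (fun d : nat =>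
      expR (\sum_(j < L.+1) h j ((q ^ j)%:R * ((d%:R + y) / q%:R)))) <=
    expR (2 * c 0%N ^+ 2) * expR (G y).
  have -> : mean (iota 0 q) (fun d : nat =>
      expR (\sum_(j < L.+1) h j ((q ^ j)%:R * ((d%:R + y) / q%:R)))) =
    expR (G y) * mean (iota 0 q) (fun d : nat => expR (h 0%N ((d%:R + y) / q%:R))).
    rewrite -meanZ; apply: eq_mean => d; rewrite -expRD big_ord_recl.
    rewrite expn0 mul1r [in RHS]addrC; congr (expR (_ + _)).
    apply: eq_bigr => j _.
    rewrite lift0 expnS natrM.
    have -> : q%:R * (q ^ j)%:R * ((d%:R + y) / q%:R) =
              (q ^ j)%:R * y + (q ^ j * d)%:R.
      by rewrite natrM; field.
    by rewrite hn.
  rewrite mulrC ler_wpM2r ?expR_ge0//; apply: mean_expR_centered => //.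
  by rewrite size_iota.
apply: (@le_trans _ _ (mean (grid q L)
    (fun y => expR (2 * c 0%N ^+ 2) * expR (G y)))).
  exact: ler_mean.
rewrite meanZ big_ord_recl mulrDr expRD ler_wpM2l ?expR_ge0//.
by apply: (IH (fun j => h j.+1) (fun j => c j.+1)).
Qed.

End Waves.
Arguments grid {R} q L.

(** * Lower bound for random sup norms *)

Section RandomSupNorm.
Variable R : realType.
Implicit Types (f : trigpoly R) (t : nat -> R) (A : seq nat).

Lemma trig_eval_seq f A x : uniq A -> {subset finsupp f <= A} ->
  trig_eval f x = \sum_(k <- A) f k * e_ k x.
Proof.
move=> uA fA; rewrite /trig_eval [RHS](bigID (mem (finsupp f)))/=.
rewrite [X in _ + X]big1 ?addr0; last first.
  by move=> k /fsfun_dflt ->; rewrite mul0r.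
rewrite -[RHS]big_filter; apply: perm_big; apply: uniq_perm.
- exact: fset_uniq.
- by rewrite filter_uniq.
- by move=> k; rewrite mem_filter; case: (boolP (k \in finsupp f)) => [/fA|].
Qed.

Lemma scale_coefE t f k : scale_coef t f k = (t k)%:C%C * f k.
Proof.
rewrite /scale_coef fsfunE; case: ifPn => // /fsfun_dflt ->.
by rewrite mulr0.
Qed.

Lemma finsupp_scale t f : {subset finsupp (scale_coef t f) <= finsupp f}.
Proof.
move=> k; rewrite !mem_finsupp scale_coefE; apply: contraNneq => ->.
by rewrite mulr0.
Qed.

Lemma trig_eval_scale t f A x : uniq A -> {subset finsupp f <= A} ->
  trig_eval (scale_coef t f) x =
  \sum_(k <- A) (t k)%:C%C * (f k * e_ k x).
Proof.
move=> uA fA; rewrite (trig_eval_seq x uA).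
  by apply: eq_bigr => k _; rewrite scale_coefE mulrA.
by move=> k /finsupp_scale /fA.
Qed.

Lemma cmod_trig_eval_le f x :
  cmod (trig_eval f x) <= \sum_(k <- finsupp f) cmod (f k).
Proof.
apply: (le_trans (cmod_sum _ _)); apply: ler_sum => k _.
by rewrite cmodM cmod_e mulr1.
Qed.

Lemma cmod_le_sup_norm f x : cmod (trig_eval f x) <= sup_norm f.
Proof.
apply: ub_le_sup; last by exists x.
exists (\sum_(k <- finsupp f) cmod (f k)) => _ [y _ <-].
exact: cmod_trig_eval_le.
Qed.

Lemma sup_norm_le f M : (forall x, cmod (trig_eval f x) <= M) ->
  sup_norm f <= M.
Proof.
move=> h; apply: ge_sup; first by exists (cmod (trig_eval f 0)), 0.
by move=> _ [x _ <-].
Qed.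

Lemma sup_norm_ge0 f : 0 <= sup_norm f.
Proof. exact: (le_trans (cmod_ge0 _) (cmod_le_sup_norm f 0)). Qed.

Definition signed_norm f t : R := sup_norm (scale_coef t f).

Lemma eq_signed_norm f t t' : {in finsupp f, t =1 t'} ->
  signed_norm f t = signed_norm f t'.
Proof.
move=> tt'; congr sup_norm; apply/fsfunP => k; rewrite !scale_coefE.
have [kf|/fsfun_dflt ->] := boolP (k \in finsupp f); last by rewrite !mulr0.
by rewrite tt'.
Qed.

Lemma signed_norm_upd f t k v w :
  signed_norm f (upd t k v) <= signed_norm f (upd t k w) +
    `|v - w| * cmod (f k).
Proof.
apply: sup_norm_le => x; set A := undup (k :: finsupp f).
have uA : uniq A by exact: undup_uniq.
have kA : k \in A by rewrite mem_undup mem_head.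
have fA : {subset finsupp f <= A}.
  by move=> i fi; rewrite mem_undup inE fi orbT.
have E y : trig_eval (scale_coef (upd t k y) f) x = y%:C%C * (f k * e_ k x) +
    \sum_(i <- A | i != k) (t i)%:C%C * (f i * e_ i x).
  rewrite (trig_eval_scale _ x uA fA) (bigD1_seq k)//= {1}/upd eqxx.
  by congr (_ + _); apply: eq_bigr => i /negPf ik; rewrite /upd ik.
rewrite addrC -lerBlDl.
apply: le_trans (cmod_le_sup_norm (scale_coef (upd t k w) f) x).
rewrite lerBlDl !E.
have -> : (v%:C%C = (v - w)%:C%C + w%:C%C :> R[i]).
  by rewrite -rmorphD/= subrK.
rewrite mulrDl -addrA (le_trans (cmodD _ _))//.
by rewrite cmodM cmod_real cmodM cmod_e mulr1.
Qed.

(** Convexity in one coordinate: randomizing a frequency that was switched off can only increase the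
    mean norm. *)
Lemma signed_norm_midpoint f t k : t k = 0 ->
  signed_norm f t <= (signed_norm f (upd t k 1) + signed_norm f (upd t k (-1))) / 2.
Proof.
move=> tk; apply: sup_norm_le => x.
have uA := fset_uniq (finsupp f).
have fA : {subset finsupp f <= enum_fset (finsupp f)} by [].
set z1 := trig_eval (scale_coef (upd t k 1) f) x.
set z2 := trig_eval (scale_coef (upd t k (-1)) f) x.
have : 2%:R%:C%C * trig_eval (scale_coef t f) x = z1 + z2.
  rewrite /z1 /z2 !(trig_eval_scale _ x uA fA) -big_split/= mulr_sumr.
  apply: eq_bigr => i _; rewrite mulrA -mulrDl; congr (_ * _).
  rewrite -rmorphM -rmorphD; congr (_%:C)%C.
  by rewrite /upd; case: eqVneq => [->|_]; rewrite ?tk; ring.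
move=> /(congr1 (@cmod R)); rewrite cmodM cmod_real ger0_norm// => h.
have := cmodD z1 z2; have := cmod_le_sup_norm (scale_coef (upd t k 1) f) x.
have := cmod_le_sup_norm (scale_coef (upd t k (-1)) f) x.
by rewrite -/z1 -/z2 -h /signed_norm; lra.
Qed.

(** The Riesz product [rz z] favours signs that make one part of the polynomial large at one point.
    Averaging over [z] gives the density [rho], whose second moment is controlled by the grid
    martingale, and [mean_density_le] passes from the tilted mean back to the plain one. *)
Lemma mean_signed_norm_ge f A (q : nat) (v : nat -> nat) (s : R) :
  uniq A -> {subset A <= finsupp f} -> (0 < q)%N ->
  {in A, forall k, (q ^ v k %| k)%N && ~~ (q ^ (v k).+1 %| k)%N} ->
  0 < s ->
  {in A, forall k, \sum_(i <- A | v i == v k) cmod (f i) ^+ 2 <= s} ->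
  (\sum_(k <- A) cmod (f k) ^+ 2) / (64 * Num.sqrt s) <=
  mean (signs A) (signed_norm f).
Proof.
move=> uA Af q0 vP s0 fs; set S := \sum_(k <- A) _.
set F := signed_norm f; set r := Num.sqrt s.
have r0 : 0 < r by rewrite sqrtr_gt0.
have rr : r ^+ 2 = s by rewrite sqr_sqrtr// ltW.
(* Small enough for the Riesz factors to be positive, and such that the gain [S / (32 * r)] is twice
   the entropy cost [S / (64 * r)]. *)
pose t := (16 * r)^-1.
have t0 : 0 < t by rewrite invr_gt0 mulr_gt0.
pose L := (\max_(k <- A) v k).+1.
have vL k : k \in A -> (v k < L)%N by move=> kA; rewrite ltnS leq_bigmax_seq.
pose Z : seq (bool * R) := [seq (b, x) | b <- [:: true; false], x <- grid q L].
pose u (z : bool * R) (k : nat) := part z.1 (f k * e_ k z.2).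
have sG : (0 < size (grid q L : seq R))%N by rewrite size_grid expn_gt0 q0.
have sZ : (0 < size Z)%N by rewrite /Z size_allpairs muln_gt0 sG.
have uf z k : `|u z k| <= cmod (f k).
  by apply: (le_trans (norm_part_le _ _)); rewrite cmodM cmod_e mulr1.
have fr k : k \in A -> cmod (f k) <= r.
  move=> kA; rewrite -ler_sqr ?nnegrE ?cmod_ge0 ?(ltW r0)// rr.
  apply: (le_trans _ (fs k kA)); rewrite big_mkcond (bigD1_seq k)//= eqxx.
  by rewrite lerDl sumr_ge0// => i _; case: ifP => // _; exact: sqr_ge0.
pose rz z e := \prod_(k <- A) (1 + t * u z k * e k).
pose rho e := mean Z (rz ^~ e).
have tu z k e : k \in A -> sign_vector A e -> `|t * u z k * e k| <= 1.
  move=> kA /(_ k); rewrite kA => h.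
  have -> : `|t * u z k * e k| = t * `|u z k|.
    rewrite !normrM (gtr0_norm t0).
    by case: h => ->; rewrite ?normrN normr1 mulr1.
  rewrite /t mulrC ler_pdivrMr ?mulr_gt0// mul1r.
  by have := uf z k; have := fr k kA; lra.
have rho0 e : sign_vector A e -> 0 <= rho e.
  move=> he; rewrite /rho -(mean_cst 0 sZ); apply: ler_mean => z.
  rewrite /rz big_seq; apply: prodr_ge0 => k kA.
  by have := tu z k e kA he; rewrite ler_norml; lra.
have rho1 : mean (signs A) rho = 1.
  rewrite /rho mean_exchange -[RHS](mean_cst 1 sZ); apply: eq_mean => z.
  rewrite (mean_signs_prod (fun k y => 1 + t * u z k * y) uA).
  by rewrite big1_seq// => k _; lra.
pose sj j := \sum_(i <- A | v i == j) cmod (f i) ^+ 2.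
have sums (G : nat -> R) : \sum_(k <- A) G k =
    \sum_(j < L) \sum_(k <- A | v k == j) G k.
  rewrite [RHS](exchange_big_dep xpredT)//=; apply: eq_big_seq => k kA.
  by rewrite (big_pred1 (Ordinal (vL k kA))).
have sj_le : \sum_(j < L) sj j ^+ 2 <= s * S.
  rewrite /S sums mulr_sumr; apply: ler_sum => j _; rewrite expr2.
  rewrite ler_wpM2r ?sumr_ge0// => [i _|]; first exact: sqr_ge0.
  have [/hasP[k kA /eqP <-]|/hasPn no] := boolP (has (fun k => v k == j) A).
    exact: fs.
  by rewrite /sj big1_seq ?ltW// => k /andP[kj /no]; rewrite kj.
(* The square expands over pairs [z], [z'], and the sign mean of [rz z * rz z'] is the product of
   the [1 + t ^+ 2 * u z' k * u z k]. With [z'] fixed, the resulting exponent is a martingale in the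
   point of [z]. *)
have rho2 : mean (signs A) (fun e => rho e ^+ 2) <=
    expR (2 * t ^+ 4 * (s * S)).
  have E z z' : mean (signs A) (fun e => rz z e * rz z' e) <=
      expR (\sum_(k <- A) t ^+ 2 * u z' k * u z k).
    rewrite (@eq_mean _ _ _ _ (fun e : nat -> R => \prod_(k <- A)
        ((1 + t * u z k * e k) * (1 + t * u z' k * e k)))).
      rewrite (mean_signs_prod (fun k y =>
        (1 + t * u z k * y) * (1 + t * u z' k * y)) uA) expR_sum big_seq [leRHS]big_seq.
      apply: ler_prod => k kA.
      have tz := @tu z k (fun i => (i \in A)%:R) kA.
      (* The all-plus vector on [A] extracts [|t * u z k| <= 1] from [tu]. *)
      have e1 : sign_vector A (fun i => (i \in A)%:R : R).
        by move=> i; case: (i \in A) => //; left.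
      have := tu z k _ kA e1; have := tu z' k _ kA e1.
      rewrite /= kA !mulr1 !ler_norml => h' h; apply/andP; split; first nra.
      apply: le_trans (expR_ge1Dx _); lra.
    by move=> e; rewrite /rz -big_split.
  have -> : mean (signs A) (fun e => rho e ^+ 2) =
      mean Z (fun z' => mean Z (fun z =>
        mean (signs A) (fun e => rz z e * rz z' e))).
    under [RHS]eq_mean do rewrite -mean_exchange.
    rewrite -mean_exchange; apply: eq_mean => e.
    rewrite expr2 {1}/rho -meanZ; apply: eq_mean => z'.
    by rewrite mulrC -meanZ; apply: eq_mean => z; rewrite mulrC.
  rewrite -[leRHS](mean_cst _ sZ); apply: ler_mean => z'.
  apply: (le_trans (ler_mean _ (fun z => E z z'))).
  rewrite /Z mean_allpairs -[leRHS](@mean_cst _ _ [:: true; false])//.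
  apply: ler_mean => b.
  (* Since [e_ k x] is the frequency [k %/ q ^ v k] at [q ^ v k * x], and [q] does not divide that
     frequency, [h j] has mean 0 over the preimages. *)
  pose h j x := \sum_(k <- A | v k == j)
     t ^+ 2 * u z' k * part b (f k * e_ (k %/ q ^ v k) x).
  pose c j := t ^+ 2 * sj j.
  apply: le_trans (_ : expR (2 * \sum_(j < L) c j ^+ 2) <= _); last first.
    rewrite ler_expR -mulrA ler_pM2l//.
    under eq_bigr do rewrite exprMn -exprM.
    by rewrite -mulr_sumr ler_wpM2l// exprn_ge0// ltW.
  apply: le_trans (_ : mean (grid q L)
    (fun x => expR (\sum_(j < L) h j ((q ^ j)%:R * x))) <= _).
    apply: ler_mean => x; rewrite ler_expR sums le_eqVlt; apply/orP; left.
    apply/eqP; apply: eq_bigr => j _; rewrite /h big_seq_cond [RHS]big_seq_cond.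
    apply: eq_bigr => k /andP[kA /eqP vj]; rewrite /u/=.
    have /andP[qk _] := vP k kA.
    by rewrite -vj -e_dilate mulnC divnK.
  apply: mean_grid_expR => //.
  - move=> j x; apply: eq_bigr => k _; by rewrite e_periodic.
  - move=> j y; rewrite /h exchange_big big_seq_cond big1// => k /andP[kA /eqP vj].
    rewrite -mulr_sumr -part_sum -mulr_sumr sum_e_eq0 ?mulr0 ?part0 ?mulr0//.
    have /andP[qk nqk] := vP k kA.
    by apply: contra nqk; rewrite dvdn_divRL// expnS mulnC.
  - move=> j x; rewrite /h /c /sj mulr_sumr (le_trans (ler_norm_sum _ _ _))//.
    apply: ler_sum => k _; rewrite -mulrA normrM (ger0_norm (sqr_ge0 t)) normrM.
    rewrite ler_pM2l ?exprn_gt0// expr2 ler_pM ?normr_ge0//.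
    by apply: (le_trans (norm_part_le _ _)); rewrite cmodM cmod_e mulr1.
(* This choice equates the two cost terms [2 * lam ^+ 2 * S] and [2 * t ^+ 4 * (s * S)], as
   [s = r ^+ 2]. *)
pose lam := t ^+ 2 * r.
have lam0 : 0 < lam by rewrite mulr_gt0 ?exprn_gt0.
have conc := @mean_signs_expR_bounded_diff R A F (fun k => cmod (f k)) lam uA.
have {}conc := conc _.
have : mean (signs A) (fun e => F e * rho e) <=
    mean (signs A) F + (2 * lam ^+ 2 * S + 2 * t ^+ 4 * (s * S)) / lam.
  apply: mean_density_le => //; apply: conc.
  move=> e k x y _ x1 y1; rewrite lerBlDl (le_trans (signed_norm_upd f e k x y))//.
  rewrite lerD2l ler_wpM2r ?cmod_ge0//.
  by case: x1 => ->; case: y1 => ->; rewrite ler_norml; lra.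
have -> : (2 * lam ^+ 2 * S + 2 * t ^+ 4 * (s * S)) / lam = S / (64 * r).
  have rn0 : r != 0 by rewrite gt_eqF.
  by rewrite -rr /lam /t; field.
suff : S / (32 * r) <= mean (signs A) (fun e => F e * rho e).
  have rn0 : r != 0 by rewrite gt_eqF.
  have -> : S / (32 * r) = S / (64 * r) + S / (64 * r) by field.
  lra.
(* Under the weight [rz z] the sign [e j] has mean [t * u z j]; the sum of the [u z j * e j] is a
   part of the randomized polynomial at [z.2], hence at most [F e]. *)
have lowz z : t * \sum_(k <- A) u z k ^+ 2 <= mean (signs A) (fun e => F e * rz z e).
  apply: (@le_trans _ _ (mean (signs A) (fun e => \sum_(j <- A) \prod_(k <- A)
     ((1 + t * u z k * e k) * (if k == j then u z k * e k else 1))))).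
    rewrite mean_sum mulr_sumr; rewrite big_seq [leRHS]big_seq.
    apply: ler_sum => j jA.
    rewrite (mean_signs_prod (fun k y =>
      (1 + t * u z k * y) * (if k == j then u z k * y else 1)) uA).
    rewrite (bigD1_seq j)//= eqxx big1.
      by rewrite mulr1; nra.
    by move=> k /negPf ->; lra.
  apply: ler_mean_signs => e he.
  have -> : \sum_(j <- A) \prod_(k <- A)
     ((1 + t * u z k * e k) * (if k == j then u z k * e k else 1)) =
     (\sum_(j <- A) u z j * e j) * rz z e.
    rewrite mulr_suml; apply: eq_big_seq => j jA.
    rewrite big_split mulrC; congr (_ * _).
    by rewrite (bigD1_seq j)//= eqxx big1 ?mulr1// => k /negPf ->.
  rewrite ler_wpM2r//.
    rewrite /rz big_seq; apply: prodr_ge0 => k kA.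
    by have := tu z k e kA he; rewrite ler_norml; lra.
  apply: le_trans (cmod_le_sup_norm (scale_coef e f) z.2).
  apply: (le_trans _ (norm_part_le z.1 _)); apply: (le_trans _ (ler_norm _)).
  have fA : {subset finsupp f <= enum_fset (finsupp f)} by [].
  rewrite (trig_eval_scale _ _ (fset_uniq _) fA) part_sum.
  rewrite [leRHS](bigID (mem A))/= [X in _ + X]big1 ?addr0; last first.
    move=> k kA; have := he k; rewrite (negPf kA) => ->.
    by rewrite partZ mul0r.
  rewrite -[leRHS]big_filter le_eqVlt; apply/orP; left; apply/eqP.
  under [RHS]eq_bigr do rewrite partZ mulrC.
  apply: perm_big; apply: uniq_perm => //.
    by rewrite filter_uniq// fset_uniq.
  by move=> k; rewrite mem_filter; case: (boolP (k \in A)) => [/Af|].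
have -> : mean (signs A) (fun e => F e * rho e) =
    mean Z (fun z => mean (signs A) (fun e => F e * rz z e)).
  rewrite -mean_exchange; apply: eq_mean => e.
  by rewrite /rho -meanZ.
apply: le_trans (ler_mean _ lowz).
rewrite meanZ mean_sum.
have -> : \sum_(k <- A) mean Z (fun z => u z k ^+ 2) = S / 2.
  rewrite /S mulr_suml; apply: eq_bigr => k _.
  rewrite /Z mean_allpairs mean_exchange -[RHS](mean_cst _ sG).
  apply: eq_mean => x; rewrite /mean/= !big_cons big_nil addr0 /u/= sqr_cmod.
  by rewrite cmodM cmod_e mulr1.
rewrite /t le_eqVlt; apply/orP; left; apply/eqP; field.
by rewrite gt_eqF.
Qed.

End RandomSupNorm.

(** * Rider norms as means over sign vectors *)

Section NonmeasurableIntegral.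
Context (d : measure_display) (T : measurableType d) (R : realType).
Variable mu : {measure set T -> \bar R}.
Local Open Scope ereal_scope.

(** The integral of a nonnegative function is a supremum over the simple functions below it, hence
    monotone for arbitrary functions. The random sup norm is thus handled without establishing its
    measurability. *)
Lemma ge0_le_integral_nonmeasurable (f g : T -> \bar R) :
  (forall x, 0 <= f x) -> (forall x, f x <= g x) ->
  \int[mu]_x f x <= \int[mu]_x g x.
Proof.
move=> f0 fg; have g0 x : 0 <= g x by exact: le_trans (fg x).
rewrite !ge0_integralTE//; apply: le_ereal_sup => _ [h hf <-].
by exists h => // x; exact: le_trans (fg x).
Qed.

(** [f] lies between two modifications of [g] on a null set, with values 0 and [+oo] there; both are
    measurable and have the integral of [g]. *)
Lemma ge0_ae_eq_integral_nonmeasurable (f g : T -> \bar R) :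
  (forall x, 0 <= f x) -> (forall x, 0 <= g x) ->
  measurable_fun [set: T] g ->
  {ae mu, forall x, f x = g x} -> \int[mu]_x f x = \int[mu]_x g x.
Proof.
move=> f0 g0 mg [N [mN N0 fgN]].
have fg x : ~ N x -> f x = g x by move=> nx; apply: contrapT => /fgN.
pose g' (c : \bar R) x := if x \in N then c else g x.
have g'E c : 0 <= c -> \int[mu]_x g' c x = \int[mu]_x g x.
  move=> c0; apply: ge0_ae_eq_integral => //.
  - apply: measurable_fun_ifT => //; first last.
    by apply: (measurable_fun_bool true); rewrite setTI preimage_mem_true.
  - by move=> x _; rewrite /g'; case: ifP.
  - exists N; split => // x; rewrite /g' /=; apply: contra_notP => xN _.
    by rewrite ifN//; apply/negP => /set_mem.
apply/eqP; rewrite eq_le -{1}(g'E +oo)// -(g'E 0)//; apply/andP; split;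
  apply: ge0_le_integral_nonmeasurable => // x; rewrite /g'.
- by case: ifPn => [_|/negP xN]; [exact: leey|rewrite fg// => /mem_set].
- by case: ifP.
- by case: ifPn => // /negP xN; rewrite fg// => /mem_set.
Qed.

End NonmeasurableIntegral.

Section RiderNorm.
Context (R : realType) (d : measure_display) (Omega : measurableType d).
Variables (P : probability Omega R) (eps : nat -> {RV P >-> R}).
Hypothesis eps_rademacher : rademacher eps.

Let measurable_fiber k (v : R) : measurable (eps k @^-1` [set v]).
Proof. by rewrite -[X in measurable X]setTI; apply: measurable_funP. Qed.

Lemma rademacher_ae (A : seq nat) :
  {ae P, forall w, {in A, forall k, eps k w = 1 \/ eps k w = -1}}.
Proof.
elim: A => [|k A IH]; first by apply: nearW.
have kae : {ae P, forall w, eps k w = 1 \/ eps k w = -1}.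
  have [P1 P2] := eps_rademacher.2 k.
  have PU : P (eps k @^-1` [set 1] `|` eps k @^-1` [set -1]) = 1%E.
    rewrite measureU//.
      transitivity ((2^-1 : R)%:E + (2^-1 : R)%:E)%E.
        by congr (_ + _)%E.
      by rewrite -EFinD; congr EFin; lra.
    apply/seteqP; split => // w [/= h1 h2].
    by exfalso; move: h2; rewrite h1; lra.
  exists (~` (eps k @^-1` [set 1] `|` eps k @^-1` [set -1])); split.
  - by apply: measurableC; apply: measurableU.
  - by rewrite probability_setC ?PU ?subee//; exact: measurableU.
  - by [].
apply: filterS2 kae IH => w kw Aw i; rewrite inE => /orP[/eqP ->//|].
exact: Aw.
Qed.

(** Exactly one listed vector agrees with [v] on [A]. This writes a function of the random signs as
    a simple function. *)
Lemma sum_signs_eq (A : seq nat) (F : (nat -> R) -> R) (v : nat -> R) :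
  uniq A -> {in A, forall k, v k = 1 \/ v k = -1} ->
  \sum_(e <- signs A) F e * (all (fun k => v k == e k) A)%:R =
  F (fun k => if k \in A then v k else 0).
Proof.
elim: A F => [|k A IH] F /=; first by rewrite big_seq1 mulr1.
move=> /andP[kA uA] vA; rewrite big_cat !big_map.
have E y : \sum_(e <- signs A) F (upd e k y) *
    ((v k == upd e k y k) && all (fun i => v i == upd e k y i) A)%:R =
    (v k == y)%:R * F (upd (fun i => if i \in A then v i else 0) k y).
  rewrite -(IH (fun e => F (upd e k y)))//; last first.
    by move=> i iA; apply: vA; rewrite inE iA orbT.
  rewrite mulr_sumr; apply: eq_bigr => e _.
  have -> : all (fun i => v i == upd e k y i) A = all (fun i => v i == e i) A.
    apply: eq_in_all => i iA; rewrite /upd ifN//.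
    by apply: contraNneq kA => <-.
  by rewrite {2}/upd eqxx mulrCA -natrM mulnb.
rewrite /= !E.
have -> : (fun i => if i \in k :: A then v i else 0) =
    upd (fun i => if i \in A then v i else 0) k (v k).
  by apply/funext => i; rewrite inE /upd; case: eqVneq => // ->.
have n1 : (1 == -1 :> R) = false.
  by apply/negP => /eqP h; lra.
have [->|->] := vA k (mem_head _ _).
  by rewrite eqxx n1 mul1r mul0r addr0.
by rewrite eqxx eq_sym n1 mul1r mul0r add0r.
Qed.

(** Almost surely the signs are 1 or -1, so the integrand is a simple function; by independence each
    of its atoms [E e] has probability [2^-1 ^+ size A]. Any [A] containing the spectrum is allowed,
    which also makes means over different lists comparable. *)
Lemma rider_norm_mean (f : trigpoly R) (A : seq nat) :
  uniq A -> {subset finsupp f <= A} ->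
  rider_norm eps f = (mean (signs A) (signed_norm f))%:E.
Proof.
move=> uA fA; rewrite /rider_norm unlock.
pose I : {fset nat} := [fset k in A]%fset.
have IA k : (k \in I) = (k \in A) by rewrite !inE.
pose E (e : nat -> R) := \bigcap_(i in [set` I]) (eps i @^-1` [set e i]).
have mE e : measurable (E e).
  by apply: fin_bigcap_measurable => // i _; exact: measurable_fiber.
pose G w : \bar R := (\sum_(e <- signs A) (signed_norm f e)%:E * (\1_(E e) w)%:E)%E.
have F0 e : 0 <= signed_norm f e by exact: sup_norm_ge0.
have G0 e w : (0 <= (signed_norm f e)%:E * (\1_(E e) w)%:E)%E.
  by rewrite -EFinM lee_fin mulr_ge0.
have mG e : measurable_fun setT (fun w => (signed_norm f e)%:E * (\1_(E e) w)%:E)%E.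
  by apply: measurable_funeM; apply/measurable_EFinP; exact: measurable_indic.
transitivity (\int[P]_w G w)%E.
  apply: ge0_ae_eq_integral_nonmeasurable.
  - by move=> w; rewrite lee_fin sup_norm_ge0.
  - by move=> w; apply: sume_ge0.
  - by apply: emeasurable_sum.
  apply: filterS (rademacher_ae A) => w ew.
  have -> : G w = (\sum_(e <- signs A) signed_norm f e *
      (all (fun k => eps k w == e k) A)%:R)%:E.
    rewrite /G -sumEFin; apply: eq_bigr => e _; rewrite -EFinM indicE.
    congr ((_ * _%:R)%:E); congr nat_of_bool; apply/idP/allP.
      by move=> /set_mem Ew k kA; apply/eqP; apply: Ew; rewrite /= IA.
    by move=> h; apply/mem_set => k /=; rewrite IA => /h/eqP.
  rewrite sum_signs_eq//; congr EFin; apply: eq_signed_norm => k /fA kA.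
  by rewrite kA.
rewrite ge0_integral_sum//.
have PE e : sign_vector A e -> P (E e) = (2^-1 ^+ size A)%:E.
  move=> he; rewrite /E (eps_rademacher.1 I (fun i => [set e i]))//.
  rewrite (perm_big A)/=; last first.
    by apply: uniq_perm => //; exact: fset_uniq.
  rewrite big_seq (eq_bigr (fun=> (2^-1)%:E)); last first.
    by move=> k kA; have := he k; rewrite kA; have [h1 h2] := eps_rademacher.2 k;
      case=> ->.
  rewrite -big_seq prodEFin; congr EFin.
  by rewrite big_const_seq count_predT iter_mulr_1.
transitivity ((\sum_(e <- signs A) signed_norm f e * fine (P (E e)))%:E).
  rewrite -sumEFin; apply: eq_bigr => e _.
  rewrite ge0_integralZl_EFin//; last first.
    by apply/measurable_EFinP; exact: measurable_indic.
  by rewrite integral_indic// setIT EFinM fineK// fin_num_measure.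
rewrite (@eq_sum_signs R A _ (fun e => signed_norm f e * 2^-1 ^+ size A)).
  by rewrite -mulr_suml /mean size_signs natrX exprVn.
by move=> e /PE ->.
Qed.

End RiderNorm.

(** * From level sets to lp norms *)

Section LightFibers.

(* With [n = size A] points in a product of [s] copies of nat, fewer than
   [n / 2 ^ s] of them lie on heavy fibers in all [s] directions. *)
Lemma light_fibers (s : nat) (A : seq nat) (alpha : nat -> 'I_s -> nat) :
  (2 <= s)%N -> uniq A ->
  {in A &, forall k l, alpha k =1 alpha l -> k = l} ->
  exists (m : nat) (i : 'I_s),
    (size A < (2 * m.+1) ^ s)%N /\
    (3 * size A <= 4 * s * count (fun k =>
      count (fun l => alpha l i == alpha k i) A * m.+1 <= size A) A)%N.
Proof.
move=> s2 uA inj; set n := size A.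
have s0 : (0 < s)%N by exact: leq_trans s2.
have ex0 : exists m, ((2 * m) ^ s <= n)%N by exists 0%N; rewrite muln0 exp0n.
have bnd m : ((2 * m) ^ s <= n)%N -> (m <= n)%N.
  case: m => // m; apply: leq_trans.
  by rewrite (leq_trans _ (leq_pexp2l _ s0)) ?expn1//; lia.
(* [m] is the integer part of half the s-th root of [n]; a fiber is light when it has at most
   [n / m.+1] points. *)
have [m mn mmax] := ex_maxnP ex0 bnd.
have mS : (n < (2 * m.+1) ^ s)%N by rewrite ltnNge; apply/negP => /mmax; lia.
pose cnt i j := count (fun l => alpha l i == j) A.
pose light i k := (cnt i (alpha k i) * m.+1 <= n)%N.
pose Hv i := undup [seq alpha k i | k <- A & ~~ light i k].
have Hvm i : (size (Hv i) <= m)%N.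
  rewrite -ltnS -(@ltn_pmul2l n.+1)//.
  (* Heavy fibers of one direction are disjoint and have more than [n / m.+1] points each, so there
     are at most [m] of them. *)
  apply: (@leq_ltn_trans (n * m.+1)); last by rewrite ltn_pmul2r.
  apply: (@leq_trans ((\sum_(j <- Hv i) cnt i j) * m.+1)).
    rewrite mulnC big_distrl/= -sum1_size big_distrl/= big_seq [X in (_ <= X)%N]big_seq.
    apply: leq_sum => j; rewrite mem_undup => /mapP[k]; rewrite mem_filter.
    by rewrite /light -ltnNge mul1n => /andP[h _] ->.
  rewrite leq_mul2r; apply/orP; right.
  under eq_bigr do rewrite /cnt -sum1_count big_mkcond/=.
  rewrite exchange_big/= /n -sum1_size; apply: leq_sum => k _.
  rewrite -big_mkcond sum1_count.
  by rewrite (eq_count (a2 := pred1 (alpha k i))) ?count_uniq_mem ?undup_uniq ?leq_b1.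
(* A point heavy in every direction is determined by the positions of its coordinates in the lists
   [Hv i], so there are at most [m ^ s] such points, a quarter of [n] because [2 ^ s >= 4]. *)
pose HA := [seq k <- A | [forall i, ~~ light i k]].
have HAm : (size HA <= m ^ s)%N.
  pose g k : {ffun 'I_s -> 'I_m.+1} := [ffun i => inord (index (alpha k i) (Hv i))].
  pose Q := [pred x : 'I_m.+1 | (x < m)%N].
  have idx k i : k \in HA -> alpha k i \in Hv i.
    rewrite mem_filter mem_undup => /andP[/forallP h kA]; apply: map_f.
    by rewrite mem_filter h.
  have gval k i : k \in HA -> g k i = index (alpha k i) (Hv i) :> nat.
    move=> kA; rewrite ffunE inordK// ltnS (leq_trans _ (Hvm i))//.
    by rewrite index_size.
  have cQ : #|ffun_on Q : simpl_pred {ffun 'I_s -> 'I_m.+1}| = (m ^ s)%N.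
    rewrite card_ffun_on card_ord; congr (_ ^ _)%N.
    rewrite -sum1_card (eq_bigl (fun x : 'I_m.+1 => (x < m)%N))//.
    rewrite -(big_ord_widen _ (fun=> 1%N) (leqnSn m)) sum1_card card_ord//.
  rewrite -cQ -(size_map g) cardE; apply: uniq_leq_size.
    rewrite map_inj_in_uniq ?filter_uniq// => k l kH lH gkl.
    have [kA lA] : k \in A /\ l \in A.
      by move: kH lH; rewrite !mem_filter => /andP[_ ->] /andP[_ ->].
    apply: inj => // i.
    have := congr1 (fun h : {ffun 'I_s -> 'I_m.+1} => nat_of_ord (h i)) gkl.
    by rewrite /= !gval//; move=> /(index_inj 0%N); apply; exact: idx.
  move=> _ /mapP[k kH ->]; rewrite mem_enum; apply/ffun_onP => i.
  by rewrite inE gval// (leq_trans _ (Hvm i))// index_mem idx.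
have HA4 : (4 * size HA <= n)%N.
  apply: leq_trans mn; rewrite expnMn leq_mul//.
  by rewrite (@leq_pexp2l 2 2).
have cover : (n <= size HA + \sum_(i < s) count (light i) A)%N.
  rewrite /n -sum1_size /HA size_filter -sum1_count.
  under [X in (_ <= _ + X)%N]eq_bigr do rewrite -sum1_count big_mkcond.
  rewrite [X in (_ <= _ + X)%N]exchange_big [X in (_ <= X + _)%N]big_mkcond.
  rewrite -big_split/=; apply: leq_sum => k _.
  case: ifPn => // h; move/forallPn: h; case=> i; rewrite negbK => li.
  by rewrite (bigD1 i)//= li; lia.
have [i hi|no] := pickP (fun i => 3 * n <= 4 * s * count (light i) A)%N.
  by exists m, i.
exfalso.
have : (\sum_(i < s) (4 * s * count (light i) A).+1 <= \sum_(i < s) 3 * n)%N.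
  by apply: leq_sum => i _; rewrite ltnNge no.
rewrite (eq_bigr (fun i => 1 + 4 * s * count (light i) A)%N)//.
rewrite big_split -big_distrr/= !sum_nat_const card_ord muln1.
set X := (\sum_(i < s) _)%N in cover *; nia.
Qed.

End LightFibers.

(** * From weak-type to strong-type bounds *)

Section WeakToStrong.
Variable R : realType.

Lemma powR_sum_of_level_sets (p0 p : R) : 0 < p0 -> p0 < p ->
  exists2 C : R, 0 <= C & forall (K : seq nat) (a : nat -> R) (V : R),
    0 <= V -> {in K, forall k, 0 <= a k} ->
    (forall b, 0 < b ->
      (count (fun k => b < a k <= 2 * b) K)%:R <= (V / b) `^ p0) ->
    \sum_(k <- K) a k `^ p <= C * (2 * V) `^ p.
Proof.
move=> p00 p0p; pose th : R := 2 `^ (p0 - p).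
have th0 : 0 < th by rewrite powR_gt0.
have th1 : th < 1.
  have d0 : 0 < p - p0 by lra.
  have -> : th = (2 `^ (p - p0))^-1 by rewrite -powRN opprB.
  rewrite invf_lt1 ?powR_gt0//.
  have := @gt0_ltr_powR R _ d0 1 2; rewrite !nnegrE powR1; apply => //; lra.
exists (1 - th)^-1; first by rewrite invr_ge0; lra.
move=> K a V V0 a0 cnt.
have pn0 : p != 0 by rewrite gt_eqF// (lt_trans p00).
(* Otherwise the hypothesis at [b = a k / 2] bounds a count containing [k] by a number less than
   1. *)
have aV k : k \in K -> a k <= 2 * V.
  move=> kK; rewrite leNgt; apply/negP => Va.
  have b0 : 0 < a k / 2 by lra.
  have := cnt _ b0.
  have : V / (a k / 2) < 1 by rewrite ltr_pdivrMr//; lra.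
  move=> /(gt0_ltr_powR p00); rewrite !nnegrE powR1 => /(_ _ ler01).
  rewrite divr_ge0 ?(ltW b0)// => /(_ isT) h1 h2.
  have := le_lt_trans h2 h1; rewrite (ltr_nat _ _ 1) ltnS leqn0 -leqn0 leqNgt.
  by rewrite -has_count => /hasPn/(_ k kK)/negP; apply; apply/andP; split; lra.
have [V00|Vn0] := eqVneq V 0.
  rewrite big_seq big1 ?mulr_ge0 ?invr_ge0 ?powR_ge0//; first by lra.
  move=> k kK; have := aV k kK; have := a0 k kK; rewrite V00 mulr0 => x y.
  by rewrite (_ : a k = 0) ?powR0//; lra.
have {}Vn0 : 0 < V by rewrite lt_neqAle eq_sym Vn0.
have step L : \sum_(k <- K | 2 * V / 2 ^+ L < a k) a k `^ p <=
    (2 * V) `^ p * \sum_(l < L) th ^+ l.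
  elim: L => [|L IH].
    rewrite big_ord0 mulr0 big_seq_cond big1// => k /andP[/aV].
    by rewrite expr0 divr1 => h1 h2; lra.
  rewrite big_ord_recr/= mulrDr; set b := V / 2 ^+ L.
  have e0 : 0 < 2 ^+ L :> R by rewrite exprn_gt0.
  have b0 : 0 < b by rewrite divr_gt0.
  have bE : 2 * V / 2 ^+ L.+1 = b.
    by rewrite /b exprS; field; rewrite gt_eqF.
  have bE2 : 2 * V / 2 ^+ L = 2 * b by rewrite /b mulrA.
  rewrite bE (bigID (fun k => 2 * b < a k))/=; apply: lerD.
    apply: le_trans IH; rewrite bE2 le_eqVlt; apply/orP; left; apply/eqP.
    by apply: eq_bigl => k; apply/andP/idP => [[]//|h]; split => //; lra.
  apply: (@le_trans _ _ (\sum_(k <- K | b < a k <= 2 * b) (2 * b) `^ p)).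
    rewrite (eq_bigl (fun k => b < a k <= 2 * b)); last first.
      by move=> k; rewrite -leNgt.
    rewrite big_seq_cond [leRHS]big_seq_cond.
    apply: ler_sum => k /andP[kK /andP[_ ab]].
    by apply: ge0_ler_powR; rewrite ?nnegrE ?a0//; lra.
  rewrite big_const_seq iter_addr_0 -[leLHS]mulr_natl.
  apply: (@le_trans _ _ ((V / b) `^ p0 * (2 * b) `^ p)).
    by rewrite ler_wpM2r ?powR_ge0// cnt.
  have VbE : V / b = 2 ^+ L by rewrite /b; field; rewrite !gt_eqF.
  have -> : 2 * b = 2 * V * (2 ^+ L)^-1 by rewrite /b mulrA.
  rewrite VbE powRM ?mulr_ge0 ?invr_ge0 ?(ltW e0)//.
  rewrite mulrCA ler_wpM2l ?powR_ge0//.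
  have -> : th ^+ L = 2 `^ ((p0 - p) * L%:R) by rewrite powRrM powR_mulrn ?ltW.
  have -> : (2 ^+ L)^-1 = 2 `^ (- L%:R) :> R by rewrite powRN powR_mulrn.
  have -> : 2 ^+ L = 2 `^ L%:R :> R by rewrite powR_mulrn.
  rewrite -!powRrM -powRD ?pnatr_eq0 ?implybT// le_eqVlt; apply/orP; left.
  by apply/eqP; congr (_ `^ _); ring.
(* Enough shells to reach every nonzero term, since [2 ^ L >= L > 2 * V / a k]. *)
pose L := (\max_(k <- K) Num.truncn (2 * V / a k)).+1.
have aL k : k \in K -> 0 < a k -> 2 * V / 2 ^+ L < a k.
  move=> kK ak; rewrite ltr_pdivrMr ?exprn_gt0// [a k * _]mulrC -ltr_pdivrMr//.
  apply: (lt_le_trans (truncnS_gt (2 * V / a k))).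
  have -> : 2 ^+ L = (2 ^ L)%N%:R :> R by rewrite natrX.
  rewrite ler_nat.
  apply: leq_trans (ltnW (ltn_expl L _)) => //.
  by rewrite ltnS; apply: leq_bigmax_seq.
apply: (@le_trans _ _ ((2 * V) `^ p * \sum_(l < L) th ^+ l)).
  apply: le_trans (step L).
  rewrite (bigID (fun k => 2 * V / 2 ^+ L < a k))/= gerDl.
  rewrite big_seq_cond big1// => k /andP[kK ak].
  suff -> : a k = 0 by rewrite powR0.
  apply/eqP; rewrite eq_le a0// andbT leNgt; apply/negP => /(aL _ kK).
  by rewrite (negPf ak).
rewrite mulrC ler_wpM2r ?powR_ge0//.
have : (1 - th) * (\sum_(l < L) th ^+ l) <= 1.
  have := subrX1 th L; have : 0 <= th ^+ L by rewrite exprn_ge0// ltW.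
  nra.
by rewrite -ler_pdivlMl ?mulr1//; lra.
Qed.

End WeakToStrong.

(** * Rider property of the semigroup *)

Section Semigroup.
Variables (s : nat) (q : 'I_s -> nat).
Hypothesis q_ge2 : forall i, (2 <= q i)%N.
Hypothesis q_coprime : forall i j, i != j -> coprime (q i) (q j).

(** The [q i] need not be prime: a cofactor coprime to [q i >= 2] is not divisible by it, so the
    exponent is still read off by divisibility. *)
Lemma semigroup_valuation (a : 'I_s -> nat) (i : 'I_s) :
  (q i ^ a i %| \prod_(j < s) q j ^ a j)%N &&
  ~~ (q i ^ (a i).+1 %| \prod_(j < s) q j ^ a j)%N.
Proof.
rewrite (bigD1 i)//= dvdn_mulr//= expnSr dvdn_pmul2l; last first.
  by rewrite expn_gt0 (leq_trans _ (q_ge2 i)).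
set r := (\prod_(j < s | _) _)%N.
have co : coprime (q i) r.
  rewrite /r; elim/big_rec: _ => [|j x ji cx]; first exact: coprimen1.
  by rewrite coprimeMr cx andbT coprimeXr// q_coprime// eq_sym.
apply/negP => qr; have := q_ge2 i.
by move: co; rewrite /coprime (gcdn_idPl qr) => /eqP ->.
Qed.

Lemma semigroup_inj (a b : 'I_s -> nat) :
  (\prod_(j < s) q j ^ a j = \prod_(j < s) q j ^ b j)%N -> a =1 b.
Proof.
move=> ab i; have /andP[a1 a2] := semigroup_valuation a i.
have /andP[b1 b2] := semigroup_valuation b i.
apply/eqP; rewrite eqn_leq; apply/andP; split; rewrite leqNgt; apply/negP => lt.
  by move: b2; rewrite -ab (dvdn_trans (dvdn_exp2l _ lt) a1).
by move: a2; rewrite ab (dvdn_trans (dvdn_exp2l _ lt) b1).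
Qed.

End Semigroup.

Section Rider.
Context (R : realType) (d : measure_display) (Omega : measurableType d).
Variables (P : probability Omega R) (eps : nat -> {RV P >-> R}).
Hypothesis eps_rademacher : rademacher eps.
Variables (s : nat) (q : 'I_s -> nat).
Hypothesis s_ge2 : (2 <= s)%N.
Hypothesis q_ge2 : forall i, (2 <= q i)%N.
Hypothesis q_coprime : forall i j, i != j -> coprime (q i) (q j).

Lemma mean_signed_norm_sub (f : trigpoly R) (A : seq nat) :
  uniq A -> {subset A <= finsupp f} ->
  mean (signs A) (signed_norm f) <= mean (signs (finsupp f)) (signed_norm f).
Proof.
move=> uA Af; pose B := [seq k <- finsupp f | k \notin A].
have uBA : uniq (B ++ A).
  rewrite cat_uniq filter_uniq ?fset_uniq//= uA andbT.
  apply/hasPn => k kA; apply/negP; rewrite /= mem_filter.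
  by rewrite kA.
apply: (@le_trans _ _ (mean (signs (B ++ A)) (signed_norm f))).
  by apply: mean_signs_catr => // e k _; exact: signed_norm_midpoint.
(* Both means equal [rider_norm eps f], so the order of the frequencies is immaterial. *)
rewrite le_eqVlt; apply/orP; left; apply/eqP/EFin_inj.
rewrite -!(rider_norm_mean eps_rademacher)//; first exact: fset_uniq.
by move=> k kf; rewrite mem_cat mem_filter kf andbT orNb.
Qed.

(** [mean_signed_norm_ge] is applied in base [q i], for the direction [i] given by [light_fibers],
    to the points on light fibers: they form a proportion at least [3 / (4 * s)] of the level
    set. *)
Lemma semigroup_level_set (f : trigpoly R) (b : R) :
  spectrum_in (semigroup_gen q) f -> 0 < b ->
  (count (fun k => b < cmod (f k) <= 2 * b) (finsupp f))%:R <=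
  (256 * s%:R * mean (signs (finsupp f)) (signed_norm f) / b)
    `^ (2 * s%:R / (s%:R + 1)).
Proof.
move=> fq b0; set M := mean _ _.
set A := [seq k <- finsupp f | b < cmod (f k) <= 2 * b].
rewrite -size_filter -/A; set n := size A.
have [->|n0] := posnP n; first exact: powR_ge0.
have M0 : 0 <= M.
  rewrite -(mean_signs_cst (finsupp f) (0 : R)).
  by apply: ler_mean => e; exact: sup_norm_ge0.
have Af : {subset A <= finsupp f} by move=> k; rewrite mem_filter => /andP[].
have uA : uniq A by rewrite filter_uniq ?fset_uniq.
have Ab k : k \in A -> b < cmod (f k) <= 2 * b by rewrite mem_filter => /andP[].
have /choice[alpha alphaP] k : exists a : 'I_s -> nat,
    k \in finsupp f -> k = (\prod_(i < s) q i ^ a i)%N.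
  have [kf|] := boolP (k \in finsupp f); last by exists (fun=> 0%N).
  have [a ak] : semigroup_gen q k by apply: fq; rewrite -mem_finsupp.
  by exists a.
have inj : {in A &, forall k l, alpha k =1 alpha l -> k = l}.
  move=> k l /Af kf /Af lf kl; rewrite (alphaP k kf) (alphaP l lf).
  by apply: eq_bigr => i _; rewrite kl.
have [m [i [mS cnt]]] := light_fibers s_ge2 uA inj.
rewrite -/n in mS cnt.
pose light k := (count (fun l => alpha l i == alpha k i) A * m.+1 <= n)%N.
rewrite -/(light) in cnt.
pose A' := [seq k <- A | light k].
have A'A : {subset A' <= A} by move=> k; rewrite mem_filter => /andP[].
have nR0 : 0 < n%:R :> R by rewrite ltr0n.
have mR0 : 0 < m.+1%:R :> R by rewrite ltr0n.
(* A light fiber has at most [r ^+ 2] points, with coefficients at most [2 * b], so its energy is at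
   most [(2 * b * r) ^+ 2]. *)
pose r := Num.sqrt (n%:R / m.+1%:R : R).
have r0 : 0 < r by rewrite sqrtr_gt0 divr_gt0.
have rr : r ^+ 2 = n%:R / m.+1%:R by rewrite sqr_sqrtr// ltW// divr_gt0.
have := @mean_signed_norm_ge R f A' (q i) (alpha^~ i) ((2 * b * r) ^+ 2).
rewrite sqrtr_sqr gtr0_norm ?mulr_gt0// => main.
have {}main : (\sum_(k <- A') cmod (f k) ^+ 2) / (64 * (2 * b * r)) <= M.
  apply: (le_trans (main _ _ _ _ _ _)).
  - by rewrite filter_uniq.
  - by move=> k /A'A/Af.
  - exact: leq_trans (q_ge2 i).
  - move=> k /A'A/Af kf; have := semigroup_valuation q_ge2 q_coprime (alpha k) i.
    by rewrite -(alphaP k kf).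
  - by [].
  - move=> k kA'.
    have lk : light k by move: kA'; rewrite mem_filter => /andP[].
    apply: (@le_trans _ _ (\sum_(l <- A' | alpha l i == alpha k i) (2 * b) ^+ 2)).
      rewrite big_seq_cond [leRHS]big_seq_cond.
      apply: ler_sum => l /andP[/A'A/Ab/andP[_ lb] _].
      by rewrite ler_sqr ?nnegrE ?cmod_ge0// mulr_ge0// ltW.
    rewrite big_const_seq iter_addr_0 -[leLHS]mulr_natr [leRHS]exprMn rr.
    rewrite ler_wpM2l ?sqr_ge0// ler_pdivlMr// -natrM ler_nat.
    apply: leq_trans lk; rewrite leq_mul2r /A' count_filter; apply/orP; right.
    by apply: sub_count => l /andP[].
  by apply: mean_signed_norm_sub; [rewrite filter_uniq|move=> k /A'A/Af].
have sumA' : b ^+ 2 * (size A')%:R <= \sum_(k <- A') cmod (f k) ^+ 2.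
  rewrite mulr_natr -iter_addr_0 -(count_predT A') -big_const_seq.
  rewrite big_seq_cond [leRHS]big_seq_cond.
  apply: ler_sum => k /andP[/A'A/Ab/andP[kb _] _].
  by rewrite ler_sqr ?nnegrE ?cmod_ge0 ?ltW.
have sR : 2 <= s%:R :> R by rewrite (ler_nat _ 2).
have cntR : 3 * n%:R <= 4 * s%:R * (size A')%:R :> R.
  by rewrite size_filter -!natrM ler_nat.
set N' := (size A')%:R in sumA' cntR.
have h1 : b * N' <= 128 * r * M.
  have : b ^+ 2 * N' <= M * (64 * (2 * b * r)).
    by rewrite (le_trans sumA')// -ler_pdivrMr// !mulr_gt0.
  rewrite expr2 -mulrA -[M * _]mulrC => h.
  by rewrite -(ler_pM2l b0); apply: (le_trans h); lra.
have h2 : 3 * b * n%:R <= 512 * s%:R * r * M.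
  have : b * (3 * n%:R) <= b * (4 * s%:R * N') by rewrite ler_wpM2l// ltW.
  have : 4 * s%:R * (b * N') <= 4 * s%:R * (128 * r * M) by rewrite ler_wpM2l//; lra.
  lra.
set V := 256 * s%:R * M.
have V0 : 0 <= V by exact: mulr_ge0 (mulr_ge0 (ler0n _ _) (ler0n _ _)) M0.
(* Squaring [h2] and dividing by [r ^+ 2] gives [9 * b ^+ 2 * n * m.+1 <= 4 * V ^+ 2]; then [m.+1]
   is bounded below by half the s-th root of [n]. *)
have h3 : n%:R * n%:R `^ s%:R^-1 <= (V / b) ^+ 2.
  have nm : n%:R `^ s%:R^-1 <= 2 * m.+1%:R :> R.
    have -> : 2 * m.+1%:R = ((2 * m.+1%:R) ^+ s) `^ s%:R^-1 :> R.
      rewrite -powR_mulrn ?mulr_ge0// -powRrM mulfV ?powRr1 ?mulr_ge0//.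
      by rewrite pnatr_eq0 -lt0n (leq_trans _ s_ge2).
    apply: ge0_ler_powR; rewrite ?nnegrE ?exprn_ge0 ?mulr_ge0//.
    by rewrite -natrM -natrX ler_nat ltnW.
  apply: (@le_trans _ _ (n%:R * (2 * m.+1%:R))); first by rewrite ler_wpM2l.
  have h4 : (3 * b * n%:R) ^+ 2 <= (512 * s%:R * r * M) ^+ 2.
    rewrite ler_sqr ?nnegrE; first exact: h2.
      exact: mulr_ge0 (mulr_ge0 (ler0n _ _) (ltW b0)) (ler0n _ _).
    exact: mulr_ge0 (mulr_ge0 (mulr_ge0 (ler0n _ _) (ler0n _ _)) (ltW r0)) M0.
  have c0 : 0 <= m.+1%:R / n%:R :> R by rewrite divr_ge0// ltW.
  have := ler_wpM2r c0 h4.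
  have -> : (3 * b * n%:R) ^+ 2 * (m.+1%:R / n%:R) =
    9 * (b ^+ 2 * (n%:R * m.+1%:R)) :> R by field; rewrite gt_eqF.
  have -> : (512 * s%:R * r * M) ^+ 2 * (m.+1%:R / n%:R) = 4 * V ^+ 2 :> R.
    have -> : (512 * s%:R * r * M) ^+ 2 = 4 * V ^+ 2 * r ^+ 2 by rewrite /V; ring.
    by rewrite rr; field; rewrite !gt_eqF.
  have := sqr_ge0 V; rewrite expr_div_n ler_pdivlMr ?exprn_gt0//; lra.
have s1 : s%:R + 1 != 0 :> R by rewrite gt_eqF//; lra.
have s1' : s%:R != 0 :> R by rewrite gt_eqF//; lra.
have -> : n%:R = (n%:R * n%:R `^ s%:R^-1) `^ (s%:R / (s%:R + 1)) :> R.
  rewrite -{2}[n%:R]powRr1// -powRD ?pnatr_eq0 -?lt0n ?n0 ?implybT//.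
  rewrite -powRrM [X in _ `^ X](_ : _ = 1) ?powRr1//.
  by field; rewrite s1.
rewrite -mulrA [in leRHS]powRrM powR_mulrn ?divr_ge0 ?(ltW b0)//.
apply: ge0_ler_powR h3.
- by apply: divr_ge0; lra.
- by rewrite nnegrE mulr_ge0// powR_ge0.
- by rewrite nnegrE sqr_ge0.
Qed.

Lemma is_Rider_semigroup (p : R) : 2 * s%:R / (s%:R + 1) < p ->
  is_Rider eps p (semigroup_gen q).
Proof.
move=> pp0; have sR : 2 <= s%:R :> R by rewrite (ler_nat _ 2).
have p00 : 0 < 2 * s%:R / (s%:R + 1) :> R by rewrite divr_gt0//; lra.
have p0 : 0 < p by exact: lt_trans pp0.
have [C C0 CP] := powR_sum_of_level_sets p00 pp0.
exists (C `^ p^-1 * (512 * s%:R)) => f fq.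
rewrite (rider_norm_mean eps_rademacher (fset_uniq (finsupp f)))//.
rewrite -EFinM lee_fin; set M := mean _ _.
have M0 : 0 <= M.
  rewrite -(mean_signs_cst (finsupp f) (0 : R)).
  by apply: ler_mean => e; exact: sup_norm_ge0.
have V0 : 0 <= 256 * s%:R * M by exact: mulr_ge0 (mulr_ge0 (ler0n _ _) (ler0n _ _)) M0.
have := CP (finsupp f) (fun k => cmod (f k)) _ V0 (fun k _ => cmod_ge0 _)
  (fun b b0 => semigroup_level_set fq b0).
rewrite /lp_coef => h.
apply: (@le_trans _ _ ((C * (2 * (256 * s%:R * M)) `^ p) `^ p^-1)).
  apply: ge0_ler_powR; rewrite ?nnegrE ?invr_ge0 ?(ltW p0)//.
    by apply: sumr_ge0 => k _; exact: powR_ge0.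
  by rewrite mulr_ge0// powR_ge0.
rewrite powRM ?powR_ge0// -powRrM mulfV ?(gt_eqF p0)// powRr1; last first.
  exact: mulr_ge0 V0.
by rewrite le_eqVlt; apply/orP; left; apply/eqP; ring.
Qed.

End Rider.

(** * Upper bound for random sup norms *)

Section UpperBound.
Variable R : realType.

Lemma lipschitz1_MVT (g dg : R -> R) (x y : R) :
  (forall z : R, is_derive z 1 g (dg z)) -> (forall z, `|dg z| <= 1) ->
  `|g x - g y| <= `|x - y|.
Proof.
move=> gd dg1; wlog xy : x y / y <= x.
  move=> W; have [/W//|/ltW/W] := leP y x.
  by rewrite distrC [leRHS]distrC.
have [|c _ ->] := @MVT_segment R g dg y x xy (fun z _ => gd z).
  apply: continuous_subspaceT => z.
  by apply: differentiable_continuous; apply/derivable1_diffP; exact: ex_derive.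
by rewrite normrM ler_piMl.
Qed.

(** The 16 is twice 8: [2 * pi <= 8], once for the cosine and once for the sine. *)
Lemma cmod_e_sub (k : nat) (x y : R) :
  cmod (e_ k x - e_ k y) <= 16 * k%:R * `|x - y|.
Proof.
apply: (le_trans (cmod_le_parts _)).
have hpi : pi <= 4 :> R by have := @pihalf_lt2 R; lra.
have hpi0 := @pi_ge0 R.
have D : `|2 * pi * k%:R * x - 2 * pi * k%:R * y| <= 8 * k%:R * `|x - y|.
  rewrite -mulrBr normrM ler_wpM2r// ger0_norm ?mulr_ge0//.
  by rewrite ler_wpM2r//; lra.
have c1 : `|cos (2 * pi * k%:R * x) - cos (2 * pi * k%:R * y)| <=
    `|2 * pi * k%:R * x - 2 * pi * k%:R * y|.
  by apply: (@lipschitz1_MVT cos (fun z => - sin z)) => z; rewrite normrN sin_max.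
have s1 : `|sin (2 * pi * k%:R * x) - sin (2 * pi * k%:R * y)| <=
    `|2 * pi * k%:R * x - 2 * pi * k%:R * y|.
  by apply: (@lipschitz1_MVT sin cos) => z; rewrite cos_max.
rewrite /=; lra.
Qed.

Lemma near_rational (M : nat) (x : R) : (0 < M)%N -> exists2 j : nat, (j < M)%N &
  forall k, cmod (e_ k x - e_ k (j%:R / M%:R)) <= 16 * k%:R / M%:R.
Proof.
move=> M0; have MR : 0 < M%:R :> R by rewrite ltr0n.
(* An integer shift makes the point nonnegative, where [Num.truncn] is the integer part. *)
pose n := (Num.truncn (- x)).+1; pose y := x + n%:R.
have y0 : 0 <= y by have := truncnS_gt (- x); rewrite -/n /y; lra.
pose j := Num.truncn (y * M%:R).
exists (j %% M)%N; first by rewrite ltn_mod.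
move=> k; have -> : e_ k x = e_ k y by rewrite e_periodicn.
have -> : e_ k ((j %% M)%:R / M%:R : R) = e_ k (j%:R / M%:R).
  rewrite {2}(divn_eq j M) natrD natrM mulrDl mulfK ?gt_eqF//.
  by rewrite addrC e_periodicn.
apply: (le_trans (cmod_e_sub _ _ _)).
rewrite ler_wpM2l ?mulr_ge0//.
have yM0 : 0 <= y * M%:R by rewrite mulr_ge0// ltW.
have j1 : j%:R <= y * M%:R by rewrite truncn_le.
have j2 := truncnS_gt (y * M%:R); rewrite -/j -natr1 in j2.
have -> : y - j%:R / M%:R = (y * M%:R - j%:R) / M%:R by field; rewrite gt_eqF.
rewrite normrM normfV !ger0_norm ?(ltW MR)//; last by lra.
by rewrite ler_pdivrMr// mulVf ?gt_eqF//; lra.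
Qed.

(* A union bound over [M] equidistant points, off which [f] moves by at most
   1. *)
Lemma mean_signed_norm_le (f : trigpoly R) (A : seq nat) (D M : nat) (lam : R) :
  uniq A -> {subset finsupp f <= A} -> {in A, forall k, (k <= D)%N} ->
  (forall k, cmod (f k) <= 1) -> (0 < M)%N -> (16 * size A * D <= M)%N ->
  0 < lam ->
  mean (signs A) (signed_norm f) <=
    1 + 2 * (ln (4 * M%:R) + 2 * lam ^+ 2 * (size A)%:R) / lam.
Proof.
move=> uA fA AD f1 M0 DM lam0; set n := size A.
have MR : 0 < M%:R :> R by rewrite ltr0n.
pose u (b : bool) (j k : nat) := part b (f k * e_ k (j%:R / M%:R)).
pose G b j (e : nat -> R) := \sum_(k <- A) e k * u b j k.
(* One sum dominating [expR (lam * |G b j e|)] at all grid points at once; both signs of [lam]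
   produce the absolute value. *)
pose T (e : nat -> R) := \sum_(b <- [:: true; false]) \sum_(j <- iota 0 M)
  (expR (lam * G b j e) + expR (- lam * G b j e)).
have u1 b j k : `|u b j k| <= 1.
  by rewrite (le_trans (norm_part_le _ _))// cmodM cmod_e mulr1.
have GE b j e : G b j e = part b (trig_eval (scale_coef e f) (j%:R / M%:R)).
  rewrite (trig_eval_scale _ _ uA fA) part_sum; apply: eq_bigr => k _.
  by rewrite partZ.
have T_ge b j e : (j < M)%N -> expR (lam * `|G b j e|) <= T e.
  move=> jM; rewrite /T (bigD1_seq b)//=; last by case: b.
  rewrite (bigD1_seq j) ?iota_uniq ?mem_iota//=.
  have p0 (x y : R) : 0 <= expR x + expR y by rewrite addr_ge0// expR_ge0.
  apply: (@le_trans _ _ (expR (lam * G b j e) + expR (- lam * G b j e))).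
    have [g0|g0] := ger0P (G b j e); first by rewrite lerDl expR_ge0.
    by rewrite mulrN mulNr lerDr expR_ge0.
  rewrite -addrA lerDl addr_ge0 ?sumr_ge0// => i _.
  by rewrite sumr_ge0.
(* [4 * M] counts two parts, [M] points and two signs of [lam]. *)
pose c := ln (4 * M%:R) + 2 * lam ^+ 2 * n%:R : R.
(* The 1 pays for moving to a grid point; the division by 2 comes from bounding the modulus by the
   sum of its two parts. *)
have NT e : sign_vector A e -> expR (lam * (signed_norm f e - 1) / 2) <= T e.
  move=> he; have T0 : 0 < T e.
    by apply: lt_le_trans (T_ge true 0%N e M0); exact: expR_gt0.
  suff : signed_norm f e <= 1 + 2 * ln (T e) / lam.
    rewrite -lerBlDl ler_pdivlMr// => h.
    rewrite -[T e]lnK ?posrE// ler_expR; lra.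
  apply: sup_norm_le => x; have [j jM jx] := near_rational x M0.
  set F := trig_eval (scale_coef e f); set x0 := j%:R / M%:R in jx.
  have d1 : cmod (F x - F x0) <= 1.
    rewrite /F !(trig_eval_scale _ _ uA fA) -sumrB (le_trans (cmod_sum _ _))//.
    apply: (@le_trans _ _ (\sum_(k <- A) 16 * D%:R / M%:R)).
      rewrite big_seq [leRHS]big_seq; apply: ler_sum => k kA.
      rewrite -!mulrBr cmodM cmod_real.
      have -> : `|e k| = 1.
        by have := he k; rewrite kA => -[->|->]; rewrite ?normrN normr1.
      rewrite mul1r cmodM -[leRHS]mul1r ler_pM ?cmod_ge0//.
      apply: (le_trans (jx k)); rewrite ler_pM2r ?invr_gt0// ler_pM2l//.
      by rewrite ler_nat AD.
    rewrite big_const_seq count_predT iter_addr_0 -[leLHS]mulr_natl mulrA.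
    rewrite ler_pdivrMr// mul1r -!natrM ler_nat; apply: leq_trans DM.
    by rewrite mulnCA mulnA.
  have d2 : cmod (F x) <= 1 + cmod (F x0).
    by rewrite -{1}[F x](subrK (F x0)) (le_trans (cmodD _ _))// lerD2r.
  have d3 b : lam * `|part b (F x0)| <= ln (T e).
    by rewrite -ler_expR lnK ?posrE// /F /x0 -GE; exact: T_ge.
  apply: (le_trans d2); rewrite lerD2l ler_pdivlMr//.
  have := d3 true; have := d3 false.
  have := ler_wpM2l (ltW lam0) (cmod_le_parts (F x0)).
  lra.
have TM : mean (signs A) T <= expR c.
  have E b j (v : R) : v = lam \/ v = - lam ->
      mean (signs A) (fun e => expR (v * G b j e)) <= expR (2 * lam ^+ 2 * n%:R).
    move=> vl; have -> : mean (signs A) (fun e => expR (v * G b j e)) =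
        \prod_(k <- A) ((expR (v * u b j k) + expR (- (v * u b j k))) / 2).
      transitivity (mean (signs A) (fun e =>
          \prod_(k <- A) expR (v * u b j k * e k))).
        apply: eq_mean => e; rewrite /G mulr_sumr expR_sum.
        by apply: eq_bigr => k _; congr expR; ring.
      rewrite (mean_signs_prod (fun k y => expR (v * u b j k * y)) uA).
      by apply: eq_bigr => k _; rewrite mulr1 mulrN1.
    apply: (@le_trans _ _ (\prod_(k <- A) expR (2 * lam ^+ 2))).
      apply: ler_prod => k _; rewrite divr_ge0 ?addr_ge0 ?expR_ge0//=.
      apply: (le_trans (cosh_le_expR_sqr _)); rewrite ler_expR ler_pM2l//.
      have -> : (v * u b j k) ^+ 2 = lam ^+ 2 * `|u b j k| ^+ 2.
        by rewrite exprMn real_normK ?num_real//; case: vl => ->; rewrite ?sqrrN.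
      by rewrite ler_piMr ?sqr_ge0// expr_le1// u1.
    by rewrite -expR_sum big_const_seq count_predT iter_addr_0 mulr_natr.
  rewrite /T mean_sum (eq_bigr (fun b => \sum_(j <- iota 0 M)
    (mean (signs A) (fun e => expR (lam * G b j e)) +
     mean (signs A) (fun e => expR (- lam * G b j e))))); last first.
    by move=> b _; rewrite mean_sum; apply: eq_bigr => j _; rewrite meanD.
  apply: (@le_trans _ _ (\sum_(b <- [:: true; false]) \sum_(j <- iota 0 M)
    (2 * expR (2 * lam ^+ 2 * n%:R)))).
    apply: ler_sum => b _; apply: ler_sum => j _.
    have := E b j lam (or_introl erefl); have := E b j (- lam) (or_intror erefl).
    lra.
  rewrite !big_cons big_nil addr0 big_const_seq count_predT size_iota iter_addr_0.
  rewrite /c expRD lnK ?posrE ?mulr_gt0// -mulr_natl.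
  by rewrite le_eqVlt; apply/orP; left; apply/eqP; ring.
(* The tangent bound [1 + y <= expR y] at [y = lam * (signed_norm f e - 1) / 2 - c] takes the place
   of Jensen's inequality. *)
have : mean (signs A) (fun e => (1 - lam / 2 - c) + lam / 2 * signed_norm f e) <=
    mean (signs A) (fun e => expR (- c) * T e).
  apply: ler_mean_signs => e he.
  apply: (@le_trans _ _ (expR (- c) * expR (lam * (signed_norm f e - 1) / 2))).
    by rewrite -expRD; apply: le_trans (expR_ge1Dx _); lra.
  by rewrite ler_wpM2l ?expR_ge0// NT.
rewrite meanD mean_signs_cst !meanZ => h.
have : expR (- c) * mean (signs A) T <= 1.
  by rewrite expRN mulrC ler_pdivrMr ?expR_gt0// mul1r.
rewrite -lerBlDl ler_pdivlMr//; rewrite -/c => h'; lra.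
Qed.

End UpperBound.

(** * Failure of the Rider property *)

Section NotRider.
Context (R : realType) (d : measure_display) (Omega : measurableType d).
Variables (P : probability Omega R) (eps : nat -> {RV P >-> R}).
Hypothesis eps_rademacher : rademacher eps.
Variables (s : nat) (q : 'I_s -> nat).
Hypothesis s_ge2 : (2 <= s)%N.
Hypothesis q_ge2 : forall i, (2 <= q i)%N.
Hypothesis q_coprime : forall i j, i != j -> coprime (q i) (q j).

Definition semigroup_box (N : nat) : seq nat :=
  [seq (\prod_(i < s) q i ^ a i)%N | a : {ffun 'I_s -> 'I_N}].

Lemma uniq_semigroup_box N : uniq (semigroup_box N).
Proof.
rewrite map_inj_uniq ?enum_uniq// => a b /(semigroup_inj q_ge2 q_coprime) ab.
by apply/ffunP => i; apply/val_inj; exact: ab.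
Qed.

Lemma size_semigroup_box N : size (semigroup_box N) = (N ^ s)%N.
Proof. by rewrite size_map -cardE card_ffun !card_ord. Qed.

Lemma semigroup_box_le N k : k \in semigroup_box N ->
  (k <= (\prod_(i < s) q i) ^ N)%N.
Proof.
move=> /mapP[a _ ->]; rewrite (big_morph (expn^~ N) (fun x y => expnMn x y N) (exp1n N)).
apply: leq_prod => i _.
by rewrite leq_exp2l ?q_ge2// ltnW.
Qed.

Definition box_poly (N : nat) : trigpoly R :=
  [fsfun k in [fset k in semigroup_box N]%fset => 1 | 0].

Lemma box_polyE N k : box_poly N k = (k \in semigroup_box N)%:R.
Proof. by rewrite fsfunE !inE; case: ifP. Qed.

Lemma finsupp_box_poly N : finsupp (box_poly N) =i semigroup_box N.
Proof.
move=> k; rewrite mem_finsupp box_polyE.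
by case: (k \in _); rewrite ?eqxx ?oner_eq0.
Qed.

Lemma lp_coef_box_poly N p : lp_coef p (box_poly N) = (N%:R `^ s%:R) `^ p^-1.
Proof.
rewrite /lp_coef; congr (_ `^ _).
rewrite (perm_big (semigroup_box N))/=; last first.
  by apply: uniq_perm; [exact: fset_uniq|exact: uniq_semigroup_box|
    exact: finsupp_box_poly].
rewrite big_seq (eq_bigr (fun=> 1)) -?big_seq; last first.
  by move=> k kN; rewrite box_polyE kN cmod_real normr1 powR1.
rewrite big_const_seq count_predT iter_addr_0 size_semigroup_box.
by rewrite powR_mulrn// natrX.
Qed.

Lemma rider_norm_box_poly_le : exists2 K : R, 0 <= K & forall N, (0 < N)%N ->
  exists m : R, rider_norm eps (box_poly N) = m%:E /\
    0 <= m <= K * N%:R `^ ((s%:R + 1) / 2).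
Proof.
(* Chosen so that [4 * M <= W ^ N], using [64 <= 64 ^ N] and [N ^ s <= 2 ^ (s * N)]; hence
   [ln (4 * M)] grows linearly in [N]. *)
pose W := (64 * 2 ^ s * \prod_(i < s) q i)%N.
have W1 : (1 <= W)%N.
  rewrite !muln_gt0 expn_gt0/= prodn_gt0// => i.
  by rewrite (leq_trans _ (q_ge2 i)).
have lnW : 0 <= ln W%:R :> R by rewrite ln_ge0// ler1n.
exists (1 + 2 * (ln W%:R + 2)); first lra.
move=> N N0; have N1 : 1 <= N%:R :> R by rewrite ler1n.
have NR : 0 < N%:R :> R by rewrite ltr0n.
have Nn0 : N%:R != 0 :> R by rewrite gt_eqF.
have sR : 2 <= s%:R :> R by rewrite (ler_nat _ 2).
pose n := (N ^ s)%N; pose D := ((\prod_(i < s) q i) ^ N)%N.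
pose M := (16 * n * D)%N.
have n0 : (0 < n)%N by rewrite expn_gt0 N0.
have D0 : (0 < D)%N.
  by rewrite expn_gt0 prodn_gt0// => i; rewrite (leq_trans _ (q_ge2 i)).
have M0 : (0 < M)%N by rewrite !muln_gt0 n0.
(* Balances the two terms of the bound: [lam ^+ 2 * N ^ s = N], the order of [ln (4 * M)]. *)
pose lam : R := N%:R `^ ((1 - s%:R) / 2).
have lam0 : 0 < lam by rewrite powR_gt0.
have uB := uniq_semigroup_box N.
have fB : {subset finsupp (box_poly N) <= semigroup_box N}.
  by move=> k; rewrite finsupp_box_poly.
exists (mean (signs (semigroup_box N)) (signed_norm (box_poly N))).
split; first by rewrite (rider_norm_mean eps_rademacher uB).
apply/andP; split.
  rewrite -(mean_signs_cst (semigroup_box N) (0 : R)).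
  by apply: ler_mean => e; exact: sup_norm_ge0.
have := @mean_signed_norm_le R (box_poly N) (semigroup_box N) D M lam uB fB
  (@semigroup_box_le N) _ M0.
rewrite size_semigroup_box -/n leqnn => /(_ _ isT lam0) h.
apply: (le_trans (h _)) => [k|].
  rewrite box_polyE; case: (k \in _); last by rewrite cmod0.
  by rewrite cmod_real normr1.
have lM : ln (4 * M%:R) <= N%:R * ln W%:R :> R.
  rewrite -ln_powR powR_mulrn// ler_ln ?posrE ?exprn_gt0 ?mulr_gt0 ?ltr0n//.
  rewrite -natrM -natrX ler_nat /M /W !expnMn -/D !mulnA leq_mul//.
  rewrite leq_mul//; first by rewrite -{1}(expn1 (4 * 16)) leq_exp2l.
  rewrite /n -expnM mulnC expnM leq_exp2r; last by rewrite (leq_trans _ s_ge2).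
  by rewrite ltnW// ltn_expl.
have ln2 : lam ^+ 2 * n%:R = N%:R.
  rewrite -powR_mulrn ?powR_ge0// -powRrM /n natrX -powR_mulrn//.
  rewrite -powRD ?Nn0 ?implybT// -[RHS]powRr1//.
  by congr (_ `^ _); field.
set E := N%:R `^ ((s%:R + 1) / 2).
have E1 : 1 <= E.
  by have := @ler_powR R N%:R N1 0 ((s%:R + 1) / 2); rewrite powRr0; apply; lra.
have Elam : N%:R / lam = E.
  rewrite /lam -powRN -{1}[N%:R]powRr1// -powRD ?Nn0 ?implybT//.
  by rewrite /E; congr (_ `^ _); field.
apply: (@le_trans _ _ (1 + 2 * (N%:R * (ln W%:R + 2)) / lam)).
  rewrite lerD2l ler_pM2r ?invr_gt0// ler_pM2l//; rewrite -mulrA ln2; lra.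
have -> : 2 * (N%:R * (ln W%:R + 2)) / lam = 2 * (ln W%:R + 2) * (N%:R / lam).
  by ring.
rewrite Elam; lra.
Qed.

(** On [box_poly N] the coefficient norm is [N ^ (s / p)] against a Rider norm of order at most
    [N ^ ((s + 1) / 2)]; the gap [del] between the exponents is positive exactly below the critical
    [p]. *)
Lemma not_is_Rider_semigroup (p : R) : 1 <= p -> p < 2 * s%:R / (s%:R + 1) ->
  ~ is_Rider eps p (semigroup_gen q).
Proof.
move=> p1 pp0 [C CP]; have [K K0 KP] := rider_norm_box_poly_le.
have sR : 2 <= s%:R :> R by rewrite (ler_nat _ 2).
pose del := s%:R / p - (s%:R + 1) / 2 : R.
have p0 : 0 < p by lra.
have del0 : 0 < del.
  rewrite subr_gt0 ltr_pdivlMr// mulrAC ltr_pdivrMr//.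
  by rewrite mulrC -ltr_pdivlMr; lra.
pose B := `|C| * K; have B0 : 0 <= B by rewrite mulr_ge0.
(* Makes [N ^ del] exceed [B + 1], contradicting the bound [B]. *)
pose N := (Num.truncn ((B + 1) `^ del^-1)).+1.
have [m [mE /andP[m0 mK]]] := KP N isT.
have NR : 0 < N%:R :> R by rewrite ltr0n.
have Nn0 : N%:R != 0 :> R by rewrite gt_eqF.
have := CP (box_poly N); rewrite mE lp_coef_box_poly -EFinM lee_fin => /(_ _)h.
have {}h : (N%:R `^ s%:R) `^ p^-1 <= B * N%:R `^ ((s%:R + 1) / 2).
  apply: (le_trans (h _)).
    move=> k; rewrite box_polyE.
    case: (boolP (k \in _)) => [/mapP[a _ ->] _|]; last by rewrite eqxx.
    by exists (fun i => a i : nat).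
  apply: (@le_trans _ _ (`|C| * m)); first by rewrite ler_wpM2r// ler_norm.
  by rewrite /B -mulrA ler_wpM2l.
have : N%:R `^ del <= B.
  rewrite /del powRB ?Nn0 ?implybT// ler_pdivrMr ?powR_gt0//.
  by rewrite powRrM.
apply/negP; rewrite -ltNge.
apply: (@lt_trans _ _ (B + 1)); first lra.
have -> : B + 1 = ((B + 1) `^ del^-1) `^ del.
  by rewrite -powRrM mulVf ?gt_eqF// powRr1//; lra.
by apply: gt0_ltr_powR; rewrite ?nnegrE ?powR_ge0//; exact: truncnS_gt.
Qed.

End NotRider.

Lemma furstenberg_setE :
  furstenberg_set = semigroup_gen (fun i : 'I_2 => if i == ord0 then 2 else 3)%N.
Proof.
apply/seteqP; split => [n [j [k ->]]|n [a ->]].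
  exists (fun i : 'I_2 => if i == ord0 then j else k).
  by rewrite !big_ord_recl big_ord0 muln1.
by exists (a ord0), (a (lift ord0 ord0)); rewrite !big_ord_recl big_ord0 muln1.
Qed.

Theorem theorem4p10 (R : realType) (d : measure_display)
    (Omega : measurableType d) (P : probability Omega R)
    (eps : nat -> {RV P >-> R}) (eps_rademacher : rademacher eps) :
  is_Rider eps (3 / 2) furstenberg_set /\
  (forall (s : nat) (q : 'I_s -> nat),
     (2 <= s)%N ->
     (forall i, (2 <= q i)%N) ->
     (forall i j, i != j -> coprime (q i) (q j)) ->
     is_Rider eps ((2 * s%:R - 1) / s%:R) (semigroup_gen q) /\
     (forall p : R, 1 <= p -> p < 2 * s%:R / (s%:R + 1) ->
        ~ is_Rider eps p (semigroup_gen q))).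
Proof.
split.
  rewrite furstenberg_setE; apply: is_Rider_semigroup => //.
  - by move=> i; case: ifP.
  - by move=> [[|[|//]] i] [[|[|//]] j].
  - by rewrite ltr_pdivrMr; lra.
move=> s q s2 q2 co; split; last exact: not_is_Rider_semigroup.
have sR : 2 <= s%:R :> R by rewrite (ler_nat _ 2).
apply: is_Rider_semigroup => //.
(* After clearing denominators: [2 * s ^+ 2 < (2 * s - 1) * (s + 1)], that is, [1 < s]. *)
rewrite ltr_pdivrMr; last by lra.
rewrite mulrAC ltr_pdivlMr; last by lra.
nra.
Qed.
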